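(* Let $\rho:\mathbb{C}\times\mathbb{R}\to\mathbb{R}$ be a smooth function, let $S=\{(z,w)\in\mathbb{C}^2: v=\rho(z,u)\}$ (with $w=u+iv$) be a properly foliated hypersurface of $\mathbb{C}^2$, and suppose that $\rho$ is bounded. Then every complex leaf of $S$ is a complex line.
   Context: Coordinates on $\mathbb{C}^2$ are $(z,w)$ with $z=x+iy$, $w=u+iv$. $S$ is a real $3$-dimensional submanifold endowed with a foliation by real surfaces (not all leaves are assumed to be complex); a complex leaf is a leaf which is an immersed complex curve of $\mathbb{C}^2$. A leaf $\Sigma$ of a foliated $3$-submanifold $S\subset\mathbb{C}^2$ is properly embedded if, for (almost) every ball $B\subset\mathbb{C}^2$, the connected components of $\overline{B}\cap\Sigma$ are compact, embedded submanifolds of $\overline{B}\cap S$ with boundary. The foliation of $S$ is proper ($S$ is properly foliated) if its leaves are properly embedded. *)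

(* Defs.v *)
From mathcomp Require Import all_boot all_order all_algebra.
From mathcomp Require Import complex.
From mathcomp Require Import all_classical all_reals all_analysis.
From Stdlib Require Import Relation_Operators.

Set Implicit Arguments.
Unset Strict Implicit.
Unset Printing Implicit Defensive.

Import Order.TTheory GRing.Theory Num.Theory.
Import numFieldNormedType.Exports.

Local Open Scope classical_set_scope.
Local Open Scope ring_scope.

(* The [^o] makes C a normed module over itself: derivatives of functions on C
   are complex derivatives, and C * C carries the product topology. *)
Notation C R := ((R[i] : numClosedFieldType)^o) (only parsing).
Notation C2 R := (C R * C R)%type (only parsing).

Section Smooth.
Context {R : realType} {V W : normedModType R}.

(* On finite-dimensional spaces this is the usual C^k: all iterated directional
   derivatives of order at most k exist and are continuous. *)
Fixpoint Ck (k : nat) (f : V -> W) : Prop :=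
  if k is k'.+1 then
    (forall x, differentiable f x) /\ (forall v, Ck k' ('D_v f))
  else continuous f.

Definition smooth (f : V -> W) : Prop := forall k, Ck k f.

End Smooth.

Section Definitions.
Context {R : realType}.
Implicit Types (S L K : set (C2 R)) (p q c : C2 R).

(* (z, w) = (x + iy, u + iv) |-> (x, y, u, v); real differentiability of maps
   into C^2 is expressed through these coordinates. *)
Definition coords p : R * R * R * R :=
  (complex.Re p.1, complex.Im p.1, complex.Re p.2, complex.Im p.2).

Definition of_coords (a : R * R * R * R) : C2 R :=
  ((a.1.1.1 +i* a.1.1.2)%C, (a.1.2 +i* a.2)%C).

(* The norm of a product type is the max norm, hence the explicit Euclidean
   ball. *)
Definition closed_eball c (r : R) : set (C2 R) :=
  [set p | let d := coords (p - c) in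
           d.1.1.1 ^+ 2 + d.1.1.2 ^+ 2 + d.1.2 ^+ 2 + d.2 ^+ 2 <= r ^+ 2].

Definition graph (rho : C R * R -> R) : set (C2 R) :=
  [set p | complex.Im p.2 = rho (p.1, complex.Re p.2)].

Definition smooth_embedding (V : normedModType R) (psi : V -> C2 R) : Prop :=
  [/\ smooth (coords \o psi),
      forall a v, 'd (coords \o psi) a v = 0 -> v = 0,
      injective psi
    & forall a (U : set V), nbhs a U ->
        exists2 O : set (C2 R), nbhs (psi a) O & psi @^-1` O `<=` U].

(* A real surface with (possibly empty) boundary, embedded in X. *)
Definition embedded_surface_in (X K : set (C2 R)) : Prop :=
  K `<=` X /\
  forall p, K p ->
    exists (O : set (C2 R)) (psi : R * R -> C2 R),
      [/\ open O, O p, smooth_embedding psi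
        & K `&` O = range psi \/ K `&` O = psi @` [set a | 0 <= a.1]].

(* Charts are given by their inverses psi : R^2 x R -> S; the plaques of psi are
   the images of the slices R^2 x {t}. *)
Definition plaque (psi : R * R * R -> C2 R) (t : R) : set (C2 R) :=
  psi @` [set a | a.2 = t].

(* In the last clause, a change of charts locally has the form
   (a, t) |-> (h a t, g t): its last component only depends on t. *)
Definition foliated_atlas S (A : set (R * R * R -> C2 R)) : Prop :=
  [/\ forall psi, A psi -> smooth_embedding psi /\
        (exists2 O : set (C2 R), open O & range psi = S `&` O),
      forall p, S p -> exists2 psi, A psi & range psi p
    & forall psi phi p, A psi -> A phi -> range psi p -> range phi p ->
        exists O : set (C2 R), [/\ open O, O p
          & forall a a' b b', O (psi a) -> O (psi a') ->
              psi a = phi b -> psi a' = phi b' -> a.2 = a'.2 -> b.2 = b'.2]].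

Definition same_plaque (A : set (R * R * R -> C2 R)) p q : Prop :=
  exists psi t, [/\ A psi, plaque psi t p & plaque psi t q].

Definition leaf_through (A : set (R * R * R -> C2 R)) p : set (C2 R) :=
  [set q | clos_refl_trans _ (same_plaque A) p q].

Definition is_leaf S (A : set (R * R * R -> C2 R)) L : Prop :=
  exists2 p, S p & L = leaf_through A p.

(* L, with its leaf topology (a basis of which is formed by the open subsets of
   plaques), is locally parametrized by injective holomorphic immersions of
   open subsets of C. *)
Definition immersed_complex_curve (A : set (R * R * R -> C2 R)) L : Prop :=
  forall p, L p ->
    exists psi t (O : set (C2 R)) (D : set (C R)) (gam : C R -> C2 R),
      [/\ A psi /\ plaque psi t p, open O /\ O p, open D,
          (forall z, D z -> derivable gam z 1 /\ 'D_1 gam z <> 0)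
        & set_inj D gam /\ gam @` D = plaque psi t `&` O].

Definition complex_leaf S (A : set (R * R * R -> C2 R)) L : Prop :=
  is_leaf S A L /\ immersed_complex_curve A L.

Definition lebesgue5 :=
  ((((@lebesgue_measure R \x @lebesgue_measure R) \x @lebesgue_measure R)
     \x @lebesgue_measure R) \x @lebesgue_measure R)%E.

(* Balls are parametrized by the coordinates of the centre and the radius. *)
Definition properly_embedded S L : Prop :=
  {ae lebesgue5, forall b, 0 < b.2 ->
     let B := closed_eball (of_coords b.1) b.2 in
     forall p, (B `&` L) p ->
       let K := connected_component (B `&` L) p in
       compact K /\ embedded_surface_in (B `&` S) K}.

Definition properly_foliated S (A : set (R * R * R -> C2 R)) : Prop :=
  foliated_atlas S A /\ forall L, is_leaf S A L -> properly_embedded S L.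

Definition complex_line L : Prop :=
  exists a b : C2 R, b <> 0 /\ L = range (fun zeta : C R => a + zeta *: b).

End Definitions.

(* Main.v *)
(* On a complex leaf, w = u + iv is locally a holomorphic function of z, so that
   phi = A (v^2 - u^2) + b u + c v is harmonic in z; as v is bounded, phi tends
   to -oo with |u| for A > 0 (or for A = 0 when the leaf is bounded on the side
   where it would not). Every point of a leaf L lies in a compact piece of L cut
   out by a large ball, so the barrier log |z - z0| gives a Liouville argument:
   sup_L phi is approached over every disc of the z-plane, hence attained on the
   closure of L. All plaques of the closure are still complex, and the strong
   maximum principle makes w constant there: the closure of L contains a
   horizontal line {w = const} on which phi reaches its supremum. Since S is a
   graph over (z, u), either L is this line or u - const has a fixed sign on L.
   If L is not a line, it thus lies on one side of such a wall, or between two of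
   them. Affine functions phi of w then attain their supremum over L on these at
   most two walls only; a suitable one is therefore constant on L, which forces
   w itself to be constant on L, contradicting the strict inequality. *)
Require Import Defs.
From mathcomp Require Import all_boot all_order all_algebra.
From mathcomp Require Import complex.
From mathcomp Require Import all_classical all_reals all_analysis.
From mathcomp Require Import ring lra.
From Stdlib Require Import Relation_Operators.
Set Implicit Arguments.
Unset Strict Implicit.
Unset Printing Implicit Defensive.
Import Order.TTheory GRing.Theory Num.Theory.
Import numFieldNormedType.Exports.
Local Open Scope classical_set_scope.
Local Open Scope ring_scope.

(** * Second derivatives *)

(** The leaf is not known to be closed, nor to project bijectively to the z-plane, so there is no
    entire function w(z) to which the classical Liouville theorem applies. Moreover, the supremum of
    a bounded harmonic function such as [v] might be approached only as [u] goes to infinity. The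
    term [- A w^2] cures this: its real part is still harmonic, and it confines nearly maximal
    points to bounded [u]. Plaques in the closure of the leaf arise as limits and carry no
    holomorphic parametrization; what survives the limit is a closed relation between first
    derivatives. The maximum principles are therefore proved by the second derivative test in two
    real parameters. They all perturb [phi] by a function [g] of |z - z0|^2, so that one computation
    covers the Hopf and the logarithmic barriers. Properness enters through the compactness of one
    component of the leaf in a single large ball: a perturbed function has a maximum there, which
    the barrier keeps away from the boundary of the ball. *)

Lemma differentiable_ler {R : realType} {V W : normedModType R} (f : V -> W)
    (x : V) (e : R) : differentiable f x -> 0 < e ->
  \forall h \near (0 : V), `|f (x + h) - f x - 'd f x h| <= e * `|h|.
Proof.
move=> df e0; near=> h.
rewrite (diff_locallyxC df) -addrA -opprD [f x + _ + _]addrC addrK.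
near: h; exact: (littleoP _ e0).
Unshelve. all: by end_near. Qed.

(** If [c] were positive, [h1], which vanishes at [t], would be positive just to the right of [t],
    and by the mean value theorem [h] would exceed [h t] there. *)
Lemma second_derivative_le0 {R : realType} (h h1 : R -> R) (t c : R) :
  (\forall s \near t, is_derive s (1 : R) h (h1 s)) ->
  is_derive t (1 : R) h1 c -> (\forall s \near t, h s <= h t) ->
  h1 t = 0 /\ c <= 0.
Proof.
move=> dh dh1 hmax.
have /nbhs_ballP[d /= d0 hd] : nbhs t
    [set s | is_derive s (1 : R) h (h1 s) /\ h s <= h t].
  by near=> s; split; near: s.
have bd (s : R) : s \in `]t - d, t + d[ ->
    is_derive s (1 : R) h (h1 s) /\ h s <= h t.
  rewrite in_itv/= => /andP[? ?]; apply: hd.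
  by rewrite /ball/= distrC ltr_distl; apply/andP.
have tdd (s : R) : t <= s -> s < t + d -> s \in `]t - d, t + d[.
  by move=> ts sd; rewrite in_itv/= sd andbT (lt_le_trans _ ts)// gtrBl.
have tB : t \in `]t - d, t + d[ by rewrite tdd// ltrDl.
have h10 : h1 t = 0.
  have [d00 _] := bd _ tB.
  have d0' : is_derive t (1 : R) h 0.
    apply: (@derive1_at_max _ h (t - d) (t + d)) => //.
    - by rewrite lerD2l ge0_cp// ltW.
    - by move=> s /bd[[]].
    - by move=> s /bd[].
  by rewrite -(@derive_val _ _ _ _ _ _ _ d00) (@derive_val _ _ _ _ _ _ _ d0').
split=> //; rewrite leNgt; apply/negP => c0.
have : \forall s \near (0 : R)^', 0 < s^-1 *: (h1 (s *: (1 : R) + t) - h1 t).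
  have := @ex_derive _ _ _ _ _ _ _ dh1; have := @derive_val _ _ _ _ _ _ _ dh1.
  rewrite /derivable /derive => e /cvg_ex[/= l hl].
  have le : l = c by rewrite -e; apply/esym/cvg_lim.
  by rewrite le in hl; exact: (cvgr_gt c).
rewrite near_withinE => /nbhs_ballP[k /= k0 hk].
pose s := Num.min d k / 2.
have mk : 0 < Num.min d k by rewrite lt_min d0 k0.
have s0 : 0 < s by rewrite divr_gt0.
have sm : s < Num.min d k by rewrite ltr_pdivrMr// mulr_natr mulr2n ltrDl.
have /andP[sd sk] : (s < d) && (s < k) by rewrite -lt_min.
have ts : t < t + s by rewrite ltrDl.
have [||xi] := @MVT _ h h1 t (t + s) ts.
- move=> r; rewrite in_itv/= => /andP[t0 rs].
  have rb : r \in `]t - d, t + d[.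
    by rewrite tdd ?(ltW t0)// (lt_trans rs)// ltrD2l.
  by have [] := bd _ rb.
- apply: derivable_within_continuous => r; rewrite in_itv/= => /andP[t0 rs].
  have rb : r \in `]t - d, t + d[.
    by rewrite tdd// (le_lt_trans rs)// ltrD2l.
  by have [[]] := bd _ rb.
rewrite in_itv/= => /andP[x0 xs].
rewrite (addrC t s) addrK => /eqP; rewrite subr_eq => /eqP hE.
have [_] : is_derive (s + t) (1 : R) h (h1 (s + t)) /\ h (s + t) <= h t.
  by apply: bd; rewrite tdd// addrC ?ltrD2l// ltW.
rewrite hE gerDr; apply/negP; rewrite -ltNge mulr_gt0//.
have xt : 0 < xi - t by rewrite subr_gt0.
have := hk (xi - t); rewrite /ball/= sub0r normrN gtr0_norm//.
rewrite ltrBlDl (lt_trans xs) ?ltrD2l// => /(_ isT).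
rewrite gt_eqF// => /(_ isT).
by rewrite h10 subr0 [_ *: 1]mulr1 subrK pmulr_rgt0// invr_gt0.
Unshelve. all: by end_near. Qed.

Definition twice_diff {R : realType} {V W : normedModType R} (f : V -> W) :=
  (forall a, differentiable f a) /\ (forall e a, differentiable ('D_e f) a).

Lemma is_derive_line {R : realType} {V W : normedModType R} (f : V -> W)
    (a e : V) (s : R) : differentiable f (a + s *: e) ->
  is_derive s (1 : R) (fun t : R => f (a + t *: e)) ('D_e f (a + s *: e)).
Proof.
move=> df.
have E : (fun h : R => h^-1 *: (((fun t : R => f (a + t *: e)) \o shift s)
    (h *: (1 : R)) - f (a + s *: e))) =
  (fun h : R => h^-1 *: ((f \o shift (a + s *: e)) (h *: e) - f (a + s *: e))).
  apply/funext => h /=; congr (_ *: (f _ - _)).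
  by rewrite [h *: 1]mulr1 scalerDl addrCA.
have := @diff_derivable _ _ _ _ _ e df.
by split; rewrite /derivable /derive E.
Qed.

(** The second difference is symmetric in [e1] and [e2], whence the symmetry of second derivatives.
    The mean value theorem along [e1] reduces it to two values of the first derivative, each
    compared with its linear approximation at [a]. *)
Lemma second_difference {R : realType} {V : normedModType R} (f : V -> R)
    (a e1 e2 : V) (k : R) : twice_diff f -> 0 < k ->
  \forall s \near (0 : R), 0 < s ->
    `|f (a + s *: e1 + s *: e2) - f (a + s *: e1) - f (a + s *: e2) + f a
      - s ^+ 2 * 'D_e2 ('D_e1 f) a| <= k * s ^+ 2 * (2 * `|e1| + `|e2|).
Proof.
move=> [df ddf] k0.
have /nbhs_normP[d /= d0 hd] := differentiable_ler (ddf e1 a) k0.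
set N := `|e1| + `|e2| + 1.
have N0 : 0 < N by rewrite ltr_wpDl// addr_ge0.
have small (t r s : R) : 0 <= t <= s -> 0 <= r <= s -> s < d / N ->
    `|t *: e1 + r *: e2| < d.
  move=> /andP[t0 ts] /andP[r0 rs]; rewrite ltr_pdivlMr// => /(le_lt_trans _); apply.
  rewrite (le_trans (ler_normD _ _))// !normrZ !ger0_norm// /N !mulrDr mulr1.
  rewrite -[leLHS]addr0 lerD// ?lerD ?ler_wpM2r//.
  exact: le_trans ts.
near=> s => s0.
have sd : s < d / N.
  by near: s; apply: lt_nbhsl; rewrite divr_gt0.
set D1 := 'D_e1 f.
have dl (b : V) (t : R) : is_derive t (1 : R) (fun t => f (b + t *: e1)) (D1 (b + t *: e1)).
  exact: is_derive_line.
have dg (t : R) : is_derive t (1 : R)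
  (fun t => f (a + s *: e2 + t *: e1) - f (a + t *: e1))
  (D1 (a + s *: e2 + t *: e1) - D1 (a + t *: e1)).
  exact: is_deriveB.
have [|t ts] := @MVT R (fun t => f (a + s *: e2 + t *: e1) - f (a + t *: e1))
  (fun t => D1 (a + s *: e2 + t *: e1) - D1 (a + t *: e1)) 0 s s0.
  by apply: derivable_within_continuous => t _; have [] := dg t.
rewrite scale0r !addr0 subr0 (addrAC a (s *: e2) (s *: e1)) => E.
have -> : f (a + s *: e1 + s *: e2) - f (a + s *: e1) - f (a + s *: e2) + f a
  = (D1 (a + s *: e2 + t *: e1) - D1 (a + t *: e1)) * s.
  by rewrite -E; ring.
have t0s : 0 <= t <= s by move: ts; rewrite in_itv/= => /andP[/ltW -> /ltW ->].
have s0s : 0 <= s <= s by rewrite lexx ltW.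
have z0s : 0 <= (0 : R) <= s by rewrite lexx ltW.
have /hd /= h1 : ball_ Num.norm 0 d (t *: e1 + s *: e2).
  by rewrite /= sub0r normrN (small _ _ s).
have /hd /= h2 : ball_ Num.norm 0 d (t *: e1).
  rewrite /= sub0r normrN -[t *: e1]addr0 -(scale0r e2).
  by rewrite (small _ _ s).
rewrite -/D1 in h1 h2.
rewrite [in X in X <= _](_ : a + s *: e2 + t *: e1 = a + (t *: e1 + s *: e2)); last first.
  by rewrite -addrA (addrC (s *: e2)).
rewrite (@deriveE _ _ _ _ _ e2 (ddf e1 a)) -/D1.
set L1 : R := 'd D1 a e1; set L2 : R := 'd D1 a e2.
have LE1 : 'd D1 a (t *: e1) = t * L1 by rewrite linearZ.
have LE2 : 'd D1 a (t *: e1 + s *: e2) = t * L1 + s * L2.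
  by rewrite linearD/= !linearZ.
move: h1 h2; rewrite LE1 LE2 {LE1 LE2}.
set A : R := D1 (a + (_ + _)); set B : R := D1 (a + _); set C : R := D1 a => h1 h2.
have -> : (A - B) * s - s ^+ 2 * L2 =
  s * ((A - C - (t * L1 + s * L2)) - (B - C - t * L1)).
  by ring.
rewrite normrM gtr0_norm//.
have -> : k * s ^+ 2 * (2 * `|e1| + `|e2|) =
  s * (k * (s * `|e1| + s * `|e2|) + k * (s * `|e1|)) by ring.
rewrite ler_pM2l// (le_trans (ler_normB _ _))// lerD//.
  apply: (le_trans h1); rewrite ler_pM2l// (le_trans (ler_normD _ _))//.
  case/andP: t0s => t0 ts'.
  by rewrite !normrZ !ger0_norm// ?(ltW s0)// lerD2r ler_wpM2r.
apply: (le_trans h2); rewrite ler_pM2l// normrZ.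
case/andP: t0s => t0 ts'.
by rewrite ger0_norm// ler_wpM2r.
Unshelve. all: by end_near. Qed.

Lemma derive_comm {R : realType} {V : normedModType R} (f : V -> R)
    (a e1 e2 : V) : twice_diff f -> 'D_e2 ('D_e1 f) a = 'D_e1 ('D_e2 f) a.
Proof.
move=> df; apply/eqP; rewrite -subr_eq0 -normr_le0; apply/ler_addgt0Pr => k k0.
rewrite add0r.
(* The two error bounds add up to three times the sum of the norms; the summand 1 keeps [N] positive
   and the final comparison strict. *)
set N := 3 * (`|e1| + `|e2|) + 1.
have N0 : 0 < N by rewrite ltr_wpDl// mulr_ge0// addr_ge0.
have kN : 0 < k / N by rewrite divr_gt0.
have [s [s0 h1 h2]] : exists s : R, [/\ 0 < s,
  `|f (a + s *: e1 + s *: e2) - f (a + s *: e1) - f (a + s *: e2) + f a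
      - s ^+ 2 * 'D_e2 ('D_e1 f) a| <= k / N * s ^+ 2 * (2 * `|e1| + `|e2|) &
  `|f (a + s *: e2 + s *: e1) - f (a + s *: e2) - f (a + s *: e1) + f a
      - s ^+ 2 * 'D_e1 ('D_e2 f) a| <= k / N * s ^+ 2 * (2 * `|e2| + `|e1|)].
  near (0 : R)^'+ => s.
  have s0 : 0 < s by [].
  by exists s; split=> //; near: s; rewrite near_withinE;
    exact: second_difference.
rewrite -(@ler_pM2l _ (s ^+ 2)) ?exprn_gt0//.
rewrite -[X in X * `|_|](@ger0_norm _ (s ^+ 2)) ?exprn_ge0 ?ltW// -normrM.
set A := f (a + s *: e1 + s *: e2) in h1.
have AE : f (a + s *: e2 + s *: e1) = A by rewrite addrAC.
rewrite AE in h2.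
set D1 := 'D_e2 _ _ in h1 *; set D2 := 'D_e1 _ _ in h2 *.
set B := f (a + s *: e1) in h1 h2; set C := f (a + s *: e2) in h1 h2.
rewrite (_ : s ^+ 2 * (D1 - D2) = (A - C - B + f a - s ^+ 2 * D2) -
   (A - B - C + f a - s ^+ 2 * D1)); last by ring.
rewrite (le_lt_trans (ler_normB _ _))// (le_lt_trans (lerD h2 h1))//.
rewrite -mulrDr [_ * s ^+ 2]mulrC -mulrA ltr_pM2l ?exprn_gt0//.
rewrite mulrAC ltr_pdivrMr// ltr_pM2l// /N.
rewrite [X in X < _](_ : _ = 3 * (`|e1| + `|e2|)) ?ltrDl//.
by ring.
Unshelve. all: by end_near. Qed.

(** * Maximum principle on complex patches *)

(* The real part of - A w^2 + (b - i c) w, with w = u + i v. *)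
Definition quad {R : realType} (A b c u v : R) : R :=
  A * (v ^+ 2 - u ^+ 2) + b * u + c * v.

Definition dist2 {R : realType} (x0 y0 x y : R) : R :=
  (x - x0) ^+ 2 + (y - y0) ^+ 2.

(** First and second order conditions at a maximum along a curve, expanded by the chain rule. The
    barrier [g] stays general because four choices occur: the identity, zero, a multiple of the
    inverse, and a logarithm with a linear correction. *)
Lemma barrier_line {R : realType} (X Y U V X1 Y1 U1 V1 : R -> R)
    (t X2 Y2 U2 V2 A b c x0 y0 : R) (g g1 : R -> R) (g2 : R) :
  (forall s, is_derive s (1 : R) X (X1 s)) ->
  (forall s, is_derive s (1 : R) Y (Y1 s)) ->
  (forall s, is_derive s (1 : R) U (U1 s)) ->
  (forall s, is_derive s (1 : R) V (V1 s)) ->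
  is_derive t (1 : R) X1 X2 -> is_derive t (1 : R) Y1 Y2 ->
  is_derive t (1 : R) U1 U2 -> is_derive t (1 : R) V1 V2 ->
  let q := dist2 x0 y0 (X t) (Y t) in
  (\forall r \near q, is_derive r (1 : R) g (g1 r)) ->
  is_derive q (1 : R) g1 g2 ->
  (\forall s \near t,
     quad A b c (U s) (V s) - g (dist2 x0 y0 (X s) (Y s)) <=
     quad A b c (U t) (V t) - g q) ->
  let Q1 := 2 * (X t - x0) * X1 t + 2 * (Y t - y0) * Y1 t in
  (2 * A * V t + c) * V1 t + (b - 2 * A * U t) * U1 t - g1 q * Q1 = 0 /\
  2 * A * (V1 t ^+ 2 - U1 t ^+ 2) + (2 * A * V t + c) * V2
    + (b - 2 * A * U t) * U2 - g2 * Q1 ^+ 2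
    - g1 q * (2 * X1 t ^+ 2 + 2 * Y1 t ^+ 2 + 2 * (X t - x0) * X2
              + 2 * (Y t - y0) * Y2) <= 0.
Proof.
have sc (k r : R) : k *: r = k * r by [].
move=> dX dY dU dV dX1 dY1 dU1 dV1 q dg dg1 hmax Q1.
pose Q : R -> R := (X - cst x0) * (X - cst x0) + (Y - cst y0) * (Y - cst y0).
have QE s : dist2 x0 y0 (X s) (Y s) = Q s by rewrite /dist2 !expr2.
pose QQ1 : R -> R := (2 : R) *: ((X - cst x0) * X1 + (Y - cst y0) * Y1).
have dQ s : is_derive s (1 : R) Q (QQ1 s).
  have dx := is_deriveB (dX s) (is_derive_cst x0 s (1 : R)).
  have dy := is_deriveB (dY s) (is_derive_cst y0 s (1 : R)).
  have d1 := is_deriveM dx dx; have d2 := is_deriveM dy dy.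
  by apply: is_derive_eq (is_deriveD d1 d2) _; rewrite /QQ1 ?fctE /= ?sc; ring.
pose p : R -> R := A *: (V * V - U * U) + b *: U + c *: V.
pose p1 : R -> R := (2 * A) *: (V * V1 - U * U1) + b *: U1 + c *: V1.
pose h : R -> R := p - (g \o Q).
pose h1 : R -> R := p1 - (g1 \o Q) * QQ1.
have dp s : is_derive s (1 : R) p (p1 s).
  have d := is_deriveD (is_deriveD (is_deriveZ A (is_deriveB
    (is_deriveM (dV s) (dV s)) (is_deriveM (dU s) (dU s)))) (is_deriveZ b (dU s)))
    (is_deriveZ c (dV s)).
  by apply: is_derive_eq d _; rewrite /p1 !fctE /= !sc; ring.
have dp1 : is_derive t (1 : R) p1 (2 * A * (V1 t ^+ 2 - U1 t ^+ 2)
    + (2 * A * V t + c) * V2 + (b - 2 * A * U t) * U2).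
  have d1 := is_deriveM (dV t) dV1; have d2 := is_deriveM (dU t) dU1.
  have d3 := is_deriveZ (2 * A) (is_deriveB d1 d2).
  have d4 := is_deriveZ b dU1; have d5 := is_deriveZ c dV1.
  have d6 := is_deriveD d3 d4; have d := is_deriveD d6 d5.
  by apply: is_derive_eq d _; rewrite ?fctE /= ?sc; ring.
have hE s : h s = quad A b c (U s) (V s) - g (dist2 x0 y0 (X s) (Y s)).
  by rewrite QE /h /p ?fctE /= ?sc /quad !expr2.
have dQ0 : is_derive (Q t) (1 : R) g1 g2 by rewrite -QE.
have dgQ : \forall s \near t, is_derive (Q s) (1 : R) g (g1 (Q s)).
  have cQ : {for t, continuous Q}.
    by apply/differentiable_continuous/derivable1_diffP; have [] := dQ t.
  have dgQ : nbhs (Q t) [set r | is_derive r (1 : R) g (g1 r)] by rewrite -QE.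
  by have := cQ _ dgQ; rewrite /nbhs/=.
pose k2 := 2 * A * (V1 t ^+ 2 - U1 t ^+ 2) + (2 * A * V t + c) * V2
    + (b - 2 * A * U t) * U2 - g2 * Q1 ^+ 2
    - g1 q * (2 * X1 t ^+ 2 + 2 * Y1 t ^+ 2 + 2 * (X t - x0) * X2
              + 2 * (Y t - y0) * Y2).
have dh : \forall s \near t, is_derive s (1 : R) h (h1 s).
  apply: filterS dgQ => s dgs.
  have dgq := is_derive1_comp dgs (dQ s).
  apply: is_derive_eq (is_deriveB (dp s) dgq) _.
  by rewrite /h1 ?fctE /= ?sc; ring.
have dh1 : is_derive t (1 : R) h1 k2.
  have dgq := is_derive1_comp dQ0 (dQ t).
  have dQ1 : is_derive t (1 : R) QQ1
    (2 * (X1 t ^+ 2 + (X t - x0) * X2 + Y1 t ^+ 2 + (Y t - y0) * Y2)).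
    have dx := is_deriveB (dX t) (is_derive_cst x0 t 1).
    have dy := is_deriveB (dY t) (is_derive_cst y0 t 1).
    have d1 := is_deriveM dx dX1; have d2 := is_deriveM dy dY1.
    have d := is_deriveZ 2 (is_deriveD d1 d2).
    by apply: is_derive_eq d _; rewrite ?fctE /= ?sc; ring.
  apply: is_derive_eq (is_deriveB dp1 (is_deriveM dgq dQ1)) _.
  by rewrite /k2 /q QE /Q1 /QQ1 ?fctE /= ?sc; ring.
have hm : \forall s \near t, h s <= h t.
  by apply: filterS hmax => s; rewrite !hE.
case: (second_derivative_le0 dh dh1 hm) => h10 h2; split=> //.
by rewrite -h10 /h1 /p1 /= /q QE /QQ1 /Q1 ?fctE /= ?sc; ring.
Qed.

(* Coordinates of a piece of a leaf. The third clause is the vanishing of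
   dw /\ dz, i.e. dw = F dz for some slope F, as dz is injective. *)
Definition complex_patch {R : realType} (x y u v : R * R -> R) : Prop :=
  [/\ twice_diff x /\ twice_diff y, twice_diff u /\ twice_diff v,
      forall a e1 e2,
        'D_e1 u a * 'D_e2 x a - 'D_e1 v a * 'D_e2 y a =
        'D_e2 u a * 'D_e1 x a - 'D_e2 v a * 'D_e1 y a /\
        'D_e1 u a * 'D_e2 y a + 'D_e1 v a * 'D_e2 x a =
        'D_e2 u a * 'D_e1 y a + 'D_e2 v a * 'D_e1 x a
    & forall a e, 'D_e x a = 0 -> 'D_e y a = 0 -> e = 0].

(** Cramer's rule, with [d] the determinant of the two forms. If it vanished, two explicit
    combinations of [a] and [b] would lie in the common kernel, so all coefficients of the forms
    would be zero and [a] itself would lie there. *)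
Lemma plane_dual {R : realType} (l1 l2 : R * R -> R) :
  (forall k e, l1 (k *: e) = k * l1 e) -> (forall k e, l2 (k *: e) = k * l2 e) ->
  (forall e f, l1 (e + f) = l1 e + l1 f) ->
  (forall e f, l2 (e + f) = l2 e + l2 f) ->
  (forall e, l1 e = 0 -> l2 e = 0 -> e = 0) ->
  exists e1 e2, [/\ l1 e1 = 1, l2 e1 = 0, l1 e2 = 0, l2 e2 = 1
    & forall e, e = l1 e *: e1 + l2 e *: e2].
Proof.
move=> l1Z l2Z l1D l2D inj.
have sc (k r : R) : k *: r = k * r by [].
pose a := (1, 0) : R * R; pose b := (0, 1) : R * R.
have abE (e : R * R) : e = e.1 *: a + e.2 *: b.
  case: e => p q; apply/pair_equal_spec; split; rewrite /= !sc; ring.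
set d := l1 a * l2 b - l1 b * l2 a.
have d0 : d != 0.
  apply/eqP => d0.
  have k1 : l1 b *: a - l1 a *: b = 0.
    apply: inj; rewrite -scaleNr ?l1D ?l2D ?l1Z ?l2Z; first by ring.
    by rewrite -[RHS]oppr0 -d0 /d; ring.
  have k2 : l2 b *: a - l2 a *: b = 0.
    apply: inj; rewrite -scaleNr ?l1D ?l2D ?l1Z ?l2Z; last by ring.
    by rewrite -[RHS]d0 /d; ring.
  have coef (p q : R) : p *: a - q *: b = 0 -> p = 0 /\ q = 0.
    case/pair_equal_spec; rewrite /= !sc !mulr0 !mulr1 oppr0 addr0 add0r.
    by move=> -> /eqP; rewrite oppr_eq0 => /eqP ->.
  have [b10 a10] := coef _ _ k1; have [b20 a20] := coef _ _ k2.
  by have [/eqP] := inj a a10 a20; rewrite oner_eq0.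
pose e1 := (l2 b / d) *: a + (- l2 a / d) *: b.
pose e2 := (- l1 b / d) *: a + (l1 a / d) *: b.
have E1 : l1 e1 = 1 by rewrite /e1 l1D !l1Z /d; field.
have E2 : l2 e1 = 0 by rewrite /e1 l2D !l2Z /d; field.
have E3 : l1 e2 = 0 by rewrite /e2 l1D !l1Z /d; field.
have E4 : l2 e2 = 1 by rewrite /e2 l2D !l2Z /d; field.
exists e1, e2; split=> // e; apply/subr0_eq/inj.
  by rewrite -scaleN1r l1D l1Z l1D !l1Z E1 E3; ring.
by rewrite -scaleN1r l2D l2Z l2D !l2Z E2 E4; ring.
Qed.

(** The frame is adapted to [z] at the point [a] only. The second derivatives of [x] and [y] along
    it need not vanish, and must cancel later. *)
Lemma patch_frame {R : realType} (x y u v : R * R -> R) (a : R * R) :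
  complex_patch x y u v ->
  exists e1 e2, [/\ 'D_e1 x a = 1, 'D_e1 y a = 0, 'D_e2 x a = 0, 'D_e2 y a = 1
    & forall e, e = 'D_e x a *: e1 + 'D_e y a *: e2].
Proof.
move=> [[[dx _] [dy _]] _ _ inj].
apply: (@plane_dual _ (fun e => 'D_e x a) (fun e => 'D_e y a)).
- by move=> k e; rewrite !deriveE// linearZ.
- by move=> k e; rewrite !deriveE// linearZ.
- by move=> e f; rewrite !deriveE// linearD.
- by move=> e f; rewrite !deriveE// linearD.
- exact: inj.
Qed.

Lemma derive_second {R : realType} {V : normedModType R} (f : V -> R) (a e1 e2 : V) :
  twice_diff f ->
  is_derive (0 : R) (1 : R) (fun s : R => 'D_e2 f (a + s *: e1)) ('D_e1 ('D_e2 f) a).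
Proof.
move=> [_ df]; have := @is_derive_line _ _ _ ('D_e2 f) a e1 0 (df _ _).
by rewrite scale0r addr0.
Qed.

(* Indices denote derivatives along e1, e2 such that dz e1 = 1 and dz e2 = i; the
   slope is F + i G. The first equations are the derivatives of dw /\ dz = 0; they
   yield w11 + w22 = (F + i G) (z11 + z22), hence the Laplacian of the critical
   function does not depend on the second derivatives of z. *)
Lemma frame_algebra {R : realType} (F G x11 x12 x21 x22 y11 y12 y21 y22
    u11 u12 u21 u22 v11 v12 v21 v22 P Q A dx dy g1 g2 : R) :
  x21 = x12 -> y21 = y12 -> u21 = u12 -> v21 = v12 ->
  F * x12 + 0 * u11 - (G * y12 + 1 * v11)
    = - G * x11 + 1 * u12 - (F * y11 + 0 * v12) ->
  F * y12 + 1 * u11 + (G * x12 + 0 * v11)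
    = - G * y11 + 0 * u12 + (F * x11 + 1 * v12) ->
  F * x22 + 0 * u21 - (G * y22 + 1 * v21)
    = - G * x21 + 1 * u22 - (F * y21 + 0 * v22) ->
  F * y22 + 1 * u21 + (G * x22 + 0 * v21)
    = - G * y21 + 0 * u22 + (F * x21 + 1 * v22) ->
  P * G + Q * F - g1 * (2 * dx * 1 + 2 * dy * 0) = 0 ->
  P * F + Q * - G - g1 * (2 * dx * 0 + 2 * dy * 1) = 0 ->
  2 * A * (G ^+ 2 - F ^+ 2) + P * v11 + Q * u11
    - g2 * (2 * dx * 1 + 2 * dy * 0) ^+ 2
    - g1 * (2 * 1 ^+ 2 + 2 * 0 ^+ 2 + 2 * dx * x11 + 2 * dy * y11) <= 0 ->
  2 * A * (F ^+ 2 - (- G) ^+ 2) + P * v22 + Q * u22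
    - g2 * (2 * dx * 0 + 2 * dy * 1) ^+ 2
    - g1 * (2 * 0 ^+ 2 + 2 * 1 ^+ 2 + 2 * dx * x22 + 2 * dy * y22) <= 0 ->
  0 <= (dx ^+ 2 + dy ^+ 2) * g2 + g1.
Proof.
move=> -> -> -> -> H1 H2 H3 H4 F1 F2 S1 S2.
have U : u22 = F * (x11 + x22) - G * (y11 + y22) - u11 by move: H2 H3; clear; lra.
have V : v22 = F * (y11 + y22) + G * (x11 + x22) - v11 by move: H1 H4; clear; lra.
have := lerD S1 S2; rewrite U V addr0.
set L := (X in X <= _).
have -> : L = (x11 + x22) * (P * G + Q * F - g1 * (2 * dx * 1 + 2 * dy * 0))
  + (y11 + y22) * (P * F + Q * - G - g1 * (2 * dx * 0 + 2 * dy * 1))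
  - 4 * ((dx ^+ 2 + dy ^+ 2) * g2 + g1) by rewrite /L; ring.
by rewrite F1 F2 !mulr0 !add0r oppr_le0 pmulr_rge0.
Qed.

Lemma line_at_max {R : realType} {V : normedModType R} (x y u v : V -> R)
    (A b c x0 y0 : R) (g g1 : R -> R) (g2 : R) (a e : V) :
  twice_diff x -> twice_diff y -> twice_diff u -> twice_diff v ->
  let q a := dist2 x0 y0 (x a) (y a) in
  (\forall r \near q a, is_derive r (1 : R) g (g1 r)) ->
  is_derive (q a) (1 : R) g1 g2 ->
  (\forall a' \near a, quad A b c (u a') (v a') - g (q a') <=
                       quad A b c (u a) (v a) - g (q a)) ->
  let Q1 := 2 * (x a - x0) * 'D_e x a + 2 * (y a - y0) * 'D_e y a in
  (2 * A * v a + c) * 'D_e v a + (b - 2 * A * u a) * 'D_e u a - g1 (q a) * Q1 = 0 /\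
  2 * A * ('D_e v a ^+ 2 - 'D_e u a ^+ 2) + (2 * A * v a + c) * 'D_e ('D_e v) a
    + (b - 2 * A * u a) * 'D_e ('D_e u) a - g2 * Q1 ^+ 2
    - g1 (q a) * (2 * 'D_e x a ^+ 2 + 2 * 'D_e y a ^+ 2
       + 2 * (x a - x0) * 'D_e ('D_e x) a + 2 * (y a - y0) * 'D_e ('D_e y) a) <= 0.
Proof.
move=> tx ty tu tv q dg dg1 hmax.
have := @barrier_line R (fun s => x (a + s *: e)) (fun s => y (a + s *: e))
  (fun s => u (a + s *: e)) (fun s => v (a + s *: e))
  (fun s => 'D_e x (a + s *: e)) (fun s => 'D_e y (a + s *: e))
  (fun s => 'D_e u (a + s *: e)) (fun s => 'D_e v (a + s *: e))
  0 ('D_e ('D_e x) a) ('D_e ('D_e y) a) ('D_e ('D_e u) a) ('D_e ('D_e v) a)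
  A b c x0 y0 g g1 g2 (fun s => is_derive_line (tx.1 _)) (fun s => is_derive_line (ty.1 _))
  (fun s => is_derive_line (tu.1 _)) (fun s => is_derive_line (tv.1 _))
  (derive_second _ _ _ tx) (derive_second _ _ _ ty)
  (derive_second _ _ _ tu) (derive_second _ _ _ tv).
rewrite /= scale0r addr0; apply => //.
have : a + s *: e @[s --> (0 : R)] --> a.
  rewrite -[X in _ --> X]addr0; apply: cvgD; first exact: cvg_cst.
  by rewrite -[X in _ --> X](scale0r e); apply: cvgZr_tmp.
by move/(_ _ hmax); rewrite /nbhs/=.
Qed.

(** The quantity [q a * g2 + g1 (q a)] is a quarter of the Laplacian of [g (|z - z0|^2)] in z. When
    it is negative, [phi - g], with [phi] harmonic, is strictly subharmonic. *)
Lemma patch_no_max {R : realType} (x y u v : R * R -> R) (A b c x0 y0 : R)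
    (g g1 : R -> R) (g2 : R) (a : R * R) :
  complex_patch x y u v ->
  let q a := dist2 x0 y0 (x a) (y a) in
  (\forall r \near q a, is_derive r (1 : R) g (g1 r)) ->
  is_derive (q a) (1 : R) g1 g2 -> q a * g2 + g1 (q a) < 0 ->
  ~ (\forall a' \near a, quad A b c (u a') (v a') - g (q a') <=
                         quad A b c (u a) (v a) - g (q a)).
Proof.
move=> P q dg dg1 lap hmax.
have [e1 [e2 [x1 y1 x2 y2 _]]] := patch_frame a P.
case: (P) => [[tx ty] [tu tv] ct _].
have line e := line_at_max e tx ty tu tv dg dg1 hmax.
have [F1 S1] := line e1; have [F2 S2] := line e2.
have [] := ct a e1 e2; rewrite x1 y1 x2 y2 => c1 c2.
(* In this frame the tangency relations are the Cauchy-Riemann equations of w. *)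
have {}c1 : 'D_e2 u a = - 'D_e1 v a by move: c1; clear; lra.
have {}c2 : 'D_e2 v a = 'D_e1 u a by move: c2; clear; lra.
have dd (f : R * R -> R) e f' : twice_diff f -> derivable ('D_e f) a f'.
  by case=> _ df; apply/diff_derivable.
have pr (f f' : R * R -> R) e e' e'' : twice_diff f -> twice_diff f' ->
    'D_e ('D_e' f * 'D_e'' f') a =
    'D_e' f a * 'D_e ('D_e'' f') a + 'D_e'' f' a * 'D_e ('D_e' f) a.
  by move=> tf tf'; rewrite deriveM//; exact: dd.
have dpr (f f' : R * R -> R) e e' e'' : twice_diff f -> twice_diff f' ->
    derivable ('D_e' f * 'D_e'' f') a e.
  by move=> tf tf'; apply: derivableM; exact: dd.
(* With [e1] and [e2] frozen, the tangency relations are identities between functions of the point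
   and can be differentiated. *)
have f1 : 'D_e1 u * 'D_e2 x - 'D_e1 v * 'D_e2 y =
             'D_e2 u * 'D_e1 x - 'D_e2 v * 'D_e1 y :> (R * R -> R).
  by apply/funext => a'; have [] := ct a' e1 e2.
have f2 : 'D_e1 u * 'D_e2 y + 'D_e1 v * 'D_e2 x =
             'D_e2 u * 'D_e1 y + 'D_e2 v * 'D_e1 x :> (R * R -> R).
  by apply/funext => a'; have [] := ct a' e1 e2.
have E1 e :
  'D_e1 u a * 'D_e ('D_e2 x) a + 'D_e2 x a * 'D_e ('D_e1 u) a
  - ('D_e1 v a * 'D_e ('D_e2 y) a + 'D_e2 y a * 'D_e ('D_e1 v) a) =
  'D_e2 u a * 'D_e ('D_e1 x) a + 'D_e1 x a * 'D_e ('D_e2 u) a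
  - ('D_e2 v a * 'D_e ('D_e1 y) a + 'D_e1 y a * 'D_e ('D_e2 v) a).
  transitivity ('D_e ('D_e1 u * 'D_e2 x - 'D_e1 v * 'D_e2 y) a).
    by rewrite deriveB; [rewrite !pr|exact: dpr|exact: dpr].
  by rewrite f1 deriveB; [rewrite !pr|exact: dpr|exact: dpr].
have E2 e :
  'D_e1 u a * 'D_e ('D_e2 y) a + 'D_e2 y a * 'D_e ('D_e1 u) a
  + ('D_e1 v a * 'D_e ('D_e2 x) a + 'D_e2 x a * 'D_e ('D_e1 v) a) =
  'D_e2 u a * 'D_e ('D_e1 y) a + 'D_e1 y a * 'D_e ('D_e2 u) a
  + ('D_e2 v a * 'D_e ('D_e1 x) a + 'D_e1 x a * 'D_e ('D_e2 v) a).
  transitivity ('D_e ('D_e1 u * 'D_e2 y + 'D_e1 v * 'D_e2 x) a).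
    by rewrite deriveD; [rewrite !pr|exact: dpr|exact: dpr].
  by rewrite f2 deriveD; [rewrite !pr|exact: dpr|exact: dpr].
have A1 := E1 e1; have A2 := E2 e1; have A3 := E1 e2; have A4 := E2 e2.
rewrite /= x1 x2 y1 y2 c1 c2 in A1 A2 A3 A4 F1 F2 S1 S2.
move: lap; rewrite ltNge => /negP; apply.
exact: (frame_algebra (derive_comm a e1 e2 tx) (derive_comm a e1 e2 ty)
  (derive_comm a e1 e2 tu) (derive_comm a e1 e2 tv) A1 A2 A3 A4 F1 F2 S1 S2).
Qed.

(** * The coordinate z on a patch: local expansion and openness *)

Lemma connected_normed {R : realType} {V : normedModType R} :
  connected [set: V].
Proof.
have -> : [set: V] = \bigcup_(v in [set: V]) range (fun s : R => s *: v).
  apply/seteqP; split=> // v _; exists v => //; exists 1 => //.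
  by rewrite scale1r.
apply: bigcup_connected.
  by exists 0 => v _; exists 0 => //; rewrite scale0r.
move=> v _; apply: connected_continuous_connected.
  by apply/connected_intervalP.
apply: continuous_subspaceT => s.
by apply: cvgZr_tmp; exact: cvg_id.
Qed.

Lemma clopen_all {R : realType} {V : normedModType R} (T : set V) :
  T !=set0 -> closed T -> (forall a, T a -> nbhs a T) -> forall a, T a.
Proof.
move=> T0 Tc To a.
have TE := connected_normed T0.
have -> // : T = [set: V].
apply: TE; first by exists T; rewrite ?setTI// openE.
by exists T; rewrite ?setTI.
Qed.

Lemma compact_box {R : realType} (a : R * R) (r : R) :
  compact [set b : R * R | `|b - a| <= r].
Proof.
have -> : [set b : R * R | `|b - a| <= r] =
  `[a.1 - r, a.1 + r] `*` `[a.2 - r, a.2 + r].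
  apply/seteqP; split=> -[p q] /=; rewrite /Num.norm/= ge_max !ler_distl !in_itv/=.
    by move=> /andP[].
  by case=> -> ->.
by apply: compact_setX; exact: segment_compact.
Qed.

(** The estimate is uniform in [e]: by linearity two basis directions suffice, each with tolerance
    [k / 2], as the max norm dominates both coordinates. *)
Lemma derive_near {R : realType} (f : R * R -> R) (a : R * R) (k : R) :
  twice_diff f -> 0 < k ->
  \forall b \near a, forall e, `|'D_e f b - 'D_e f a| <= k * `|e|.
Proof.
move=> [df ddf] k0.
have eE (e : R * R) : e = e.1 *: ((1, 0) : R * R) + e.2 *: ((0, 1) : R * R).
  have sc (p r : R) : p *: r = p * r by [].
  by case: e => p q; apply/pair_equal_spec; split; rewrite /= !sc; ring.
have DE (e b : R * R) : 'D_e f b = e.1 * 'D_((1, 0) : R * R) f b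
                                 + e.2 * 'D_((0, 1) : R * R) f b.
  by rewrite !deriveE// {1}(eE e) linearD/= !linearZ.
have cont (e : R * R) : \forall b \near a, `|'D_e f b - 'D_e f a| <= k / 2.
  have /cvgrPdist_le/(_ _ (divr_gt0 k0 (ltr0n _ 2))) := differentiable_continuous (ddf e a).
  by apply: filterS => b; rewrite distrC.
apply: filterS2 (cont (1, 0)) (cont (0, 1)) => b hp hq e.
have [e1 e2] : `|e.1| <= `|e| /\ `|e.2| <= `|e|.
  by case: e => e1 e2; rewrite [`|(e1, e2)|]/Num.norm/= !le_max !lexx orbT.
rewrite (DE e b) (DE e a).
have gen (p q p' q' : R) : `|p - p'| <= k / 2 -> `|q - q'| <= k / 2 ->
    `|e.1 * p + e.2 * q - (e.1 * p' + e.2 * q')| <= k * `|e|.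
  move=> hpp hqq.
  have -> : e.1 * p + e.2 * q - (e.1 * p' + e.2 * q') =
    e.1 * (p - p') + e.2 * (q - q') by ring.
  apply: le_trans (ler_normD _ _) _; rewrite !normrM.
  have -> : k * `|e| = `|e| * (k / 2) + `|e| * (k / 2) by field.
  exact: lerD (ler_pM (normr_ge0 _) (normr_ge0 _) e1 hpp)
              (ler_pM (normr_ge0 _) (normr_ge0 _) e2 hqq).
exact: gen.
Qed.

(** The injectivity half of the inverse function theorem for z. Chords are compared with [dz] at [a]
    by the mean value theorem; the tolerance [(4 * N)^-1] makes the total error half the length of
    the chord, which is absorbed. *)
Lemma patch_expand {R : realType} (x y u v : R * R -> R) (a : R * R) :
  complex_patch x y u v -> exists k r : R, [/\ 0 < k, 0 < r &
    forall b b', `|b - a| <= r -> `|b' - a| <= r ->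
      k * `|b - b'| <= `|x b - x b'| + `|y b - y b'|].
Proof.
move=> P; have [e1 [e2 [_ _ _ _ eE]]] := patch_frame a P.
case: P => [[tx ty] _ _ _].
set N := `|e1| + `|e2| + 1.
have N0 : 0 < N by rewrite ltr_wpDl// addr_ge0.
have k0 : 0 < (4 * N)^-1 by rewrite invr_gt0 mulr_gt0.
have /nbhs_normP[d /= d0 hd] : nbhs a [set b |
    (forall e, `|'D_e x b - 'D_e x a| <= (4 * N)^-1 * `|e|) /\
    (forall e, `|'D_e y b - 'D_e y a| <= (4 * N)^-1 * `|e|)].
  by near=> b; split; near: b; exact: derive_near.
exists (2 * N)^-1, (d / 2); split; rewrite ?invr_gt0 ?mulr_gt0 ?divr_gt0//.
move=> b b' hb hb'.
set e := b - b'.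
have mv (f : R * R -> R) : twice_diff f ->
    (forall c, ball_ Num.norm a d c ->
      forall e, `|'D_e f c - 'D_e f a| <= (4 * N)^-1 * `|e|) ->
    `|'D_e f a| <= `|f b - f b'| + (4 * N)^-1 * `|e|.
  move=> [df _] hf.
  have [||s] := @MVT _ (fun s : R => f (b' + s *: e)) (fun s => 'D_e f (b' + s *: e)) 0 1 ltr01.
  - by move=> s _; exact: is_derive_line.
  - by apply: derivable_within_continuous => s _; have [] := @is_derive_line _ _ _ _ b' e s (df _).
  have bE : b' + e = b by rewrite addrC subrK.
  rewrite in_itv/= => /andP[s0 s1]; rewrite scale0r addr0 scale1r bE subr0 mulr1 => E.
  have /hf/(_ e) : ball_ Num.norm a d (b' + s *: e).
    rewrite /= distrC.
    have -> : b' + s *: e - a = s *: (b - a) + (1 - s) *: (b' - a).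
      have -> : b - a = e + (b' - a) by rewrite /e addrA subrK.
      rewrite [s *: (e + _)]scalerDr -[RHS]addrA -scalerDl [s + _]addrCA subrr addr0 scale1r.
      by rewrite addrA [b' + _]addrC.
    rewrite (@le_lt_trans _ _ (s * (d / 2) + (1 - s) * (d / 2)))//.
      rewrite (le_trans (ler_normD _ _))// !normrZ !ger0_norm ?subr_ge0 ?(ltW s0) ?(ltW s1)//.
      by rewrite lerD// ler_pM2l// ?subr_gt0.
    by rewrite -mulrDl addrCA subrr addr0 mul1r ltr_pdivrMr// mulr_natr mulr2n ltrDl.
  rewrite -E => h; rewrite -lerBlDl (le_trans _ h)// [leRHS]distrC.
  exact: lerB_dist.
have hx := mv x tx (fun c hc => (hd c hc).1).
have hy := mv y ty (fun c hc => (hd c hc).2).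
have : `|e| <= N * (`|'D_e x a| + `|'D_e y a|).
  rewrite {1}[e]eE (le_trans (ler_normD _ _))// !normrZ mulrDr lerD//.
    by rewrite mulrC ler_wpM2r// /N -addrA lerDl addr_ge0.
  by rewrite mulrC ler_wpM2r// /N addrAC lerDr addr_ge0.
move/le_trans/(_ (ler_wpM2l (ltW N0) (lerD hx hy))).
set X := `|x b - x b'|; set Y := `|y b - y b'|.
have -> : N * (X + (4 * N)^-1 * `|e| + (Y + (4 * N)^-1 * `|e|)) =
  N * (X + Y) + `|e| / 2 by field; rewrite gt_eqF.
rewrite -lerBlDr => h.
rewrite mulrC ler_pdivrMr ?mulr_gt0//.
have -> : (X + Y) * (2 * N) = 2 * (N * (X + Y)) by ring.
rewrite -ler_pdivrMl// (le_trans _ h)//.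
rewrite [leRHS](_ : _ = 2^-1 * `|e|)//; field.
Unshelve. all: by end_near. Qed.

Lemma dist2_ge {R : realType} (x0 y0 x y s : R) : 0 <= s ->
  s <= `|x - x0| + `|y - y0| -> s ^+ 2 <= 2 * dist2 x0 y0 x y.
Proof.
move=> s0 h; have := ler_pXn2r (ltn0Sn 1) s0 (le_trans s0 h) .
rewrite h => /idP; rewrite /= => /le_trans; apply.
rewrite /dist2 -(real_normK (num_real (x - x0))) -(real_normK (num_real (y - y0))).
move: `|x - x0| `|y - y0| => p q; rewrite -subr_ge0.
by have -> : 2 * (p ^+ 2 + q ^+ 2) - (p + q) ^+ 2 = (p - q) ^+ 2;
  [ring|exact: sqr_ge0].
Qed.

Lemma dist2_lt {R : realType} (x0 y0 x y s : R) :
  `|x - x0| < s -> `|y - y0| < s -> dist2 x0 y0 x y < 2 * s ^+ 2.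
Proof.
move=> hx hy.
have sq (t : R) : `|t| < s -> t ^+ 2 < s ^+ 2.
  move=> ts; rewrite -(real_normK (num_real t)) ltr_pXn2r//.
  by rewrite nnegrE (le_trans (normr_ge0 t))// ltW.
by rewrite /dist2 mulr_natl mulr2n ltrD// sq.
Qed.

Lemma continuous_dist2 {R : realType} {T : topologicalType} (x y : T -> R)
    (p q : R) : continuous x -> continuous y ->
  continuous (fun a => dist2 p q (x a) (y a)).
Proof.
move=> cx cy a; rewrite /dist2 /=.
by apply: cvgD; apply: cvgM; apply: cvgB; [exact: cx|exact: cvg_cst|exact: cx
  |exact: cvg_cst|exact: cy|exact: cvg_cst|exact: cy|exact: cvg_cst].
Qed.

Lemma continuous_quad {R : realType} {T : topologicalType} (u v : T -> R)
    (A b c : R) : continuous u -> continuous v ->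
  continuous (fun a => quad A b c (u a) (v a)).
Proof.
move=> cu cv a; rewrite /quad /=.
apply: cvgD; last by apply: cvgM; [exact: cvg_cst|exact: cv].
apply: cvgD; last by apply: cvgM; [exact: cvg_cst|exact: cu].
apply: cvgM; first exact: cvg_cst.
by apply: cvgB; apply: cvgM; [exact: cv|exact: cv|exact: cu|exact: cu].
Qed.

Lemma twice_diff_continuous {R : realType} {V W : normedModType R} (f : V -> W) :
  twice_diff f -> continuous f.
Proof. by move=> [df _] a; exact: differentiable_continuous. Qed.

Lemma near_norm_lt {R : realType} {V : normedModType R} (a b : V) (r : R) :
  `|b - a| < r -> \forall b' \near b, `|b' - a| < r.
Proof.
move=> br; have : `|b' - a| @[b' --> b] --> `|b - a|.
  by apply: cvg_norm; apply: cvgB; [exact: cvg_id|exact: cvg_cst].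
by move/cvgr_lt => /(_ _ br).
Qed.

(** The surjectivity half of the inverse function theorem: the squared distance to the target is
    minimized over a box, and at an interior minimum it must vanish since [dz] is onto. *)
Lemma patch_open {R : realType} (x y u v : R * R -> R) (a : R * R)
    (U : set (R * R)) : complex_patch x y u v -> nbhs a U ->
  exists2 d : R, 0 < d & forall p q, `|p - x a| < d -> `|q - y a| < d ->
    exists b, [/\ U b, x b = p & y b = q].
Proof.
move=> P /nbhs_normP[r1 /= r10 rU].
have [k [r2 [k0 r20 hk]]] := patch_expand a P.
have [[tx ty] _ _ _] := P.
pose r := Num.min (r1 / 2) r2.
have r0 : 0 < r by rewrite lt_min r20 divr_gt0.
have [rr1 rr2] : r <= r1 / 2 /\ r <= r2 by rewrite !ge_min !lexx orbT.
(* On the edge of the box z has moved by at least [k * r = 8 * d], so it is still [6 * d] away from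
   the target, too far for a minimum. *)
exists (k * r / 8) => [|p q hp hq]; first by rewrite divr_gt0// mulr_gt0.
set d := k * r / 8 in hp hq.
have d0 : 0 < d by rewrite divr_gt0// mulr_gt0.
pose m b := dist2 p q (x b) (y b).
have [cx cy] := (twice_diff_continuous tx, twice_diff_continuous ty).
have [||b bB bmin] := @compact_EVT_min _ _ m [set b | `|b - a| <= r] _ (@compact_box _ a r).
- by exists a; rewrite /= subrr normr0 ltW.
- by apply: continuous_subspaceT; exact: continuous_dist2.
rewrite inE /= in bB.
have ma : m b < 2 * d ^+ 2.
  apply: (@le_lt_trans _ _ (m a)).
    by apply: bmin; rewrite inE /= subrr normr0 ltW.
  by apply: dist2_lt; rewrite distrC.
have br : `|b - a| < r.
  rewrite lt_neqAle bB andbT; apply/eqP => bE.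
  have : 6 * d <= `|x b - p| + `|y b - q|.
    have := hk b a (le_trans bB rr2); rewrite subrr normr0 => /(_ (ltW r20)).
    rewrite bE => h.
    have hx := ler_distD p (x b) (x a); have hy := ler_distD q (y b) (y a).
    have krd : k * r = 8 * d by rewrite /d; field.
    move: h hx hy hp hq krd; clear.
    move: `|x b - x a| `|y b - y a| `|x b - p| `|p - x a| `|y b - q| `|q - y a| (k * r) d.
    by move=> *; lra.
  move/(dist2_ge (mulr_ge0 (ler0n _ 6) (ltW d0))).
  move: ma; rewrite -/(m b) => h1 h2; have : (6 * d) ^+ 2 < 4 * d ^+ 2.
    by rewrite (le_lt_trans h2)//; move: h1; clear; lra.
  have : 0 < d ^+ 2 by rewrite exprn_gt0.
  by clear; lra.
(* The squared distance plays the barrier, with [g = id] and [phi = 0]: the first order conditions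
   along [e1] and [e2] then say [x b = p] and [y b = q]. *)
have lm : \forall b' \near b, quad 0 0 0 (x b') (x b') - id (m b') <=
    quad 0 0 0 (x b) (x b) - id (m b).
  apply: filterS (near_norm_lt br) => b' /ltW b'r.
  by rewrite /quad !mul0r !addr0 !sub0r lerN2; apply: bmin; rewrite inE.
have [e1 [e2 [x1 y1 x2 y2 _]]] := patch_frame b P.
have d1 : \forall t \near m b, is_derive t (1 : R) (id : R -> R) (cst 1 t).
  by apply: filterE => t; exact: is_derive_id.
have d2 : is_derive (m b) (1 : R) (cst 1 : R -> R) 0 by exact: is_derive_cst.
have L e := line_at_max e tx ty tx tx d1 d2 lm.
have [L1 _] := L e1; have [L2 _] := L e2.
exists b; split.
- apply: rU; rewrite /= distrC (lt_le_trans br)// (le_trans rr1)//.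
  by rewrite ler_pdivrMr// mulr_natr mulr2n lerDl ltW.
- by move: L1; rewrite /= x1 y1; move: (x b) (y b); clear; move=> *; lra.
- by move: L2; rewrite /= x2 y2; move: (x b) (y b); clear; move=> *; lra.
Qed.

(** * Strong maximum principle *)

Lemma is_derive_inv {R : realType} (k t : R) : t != 0 ->
  is_derive t (1 : R) (fun s => k * s^-1) (- k * t ^- 2).
Proof.
move=> t0.
have d := is_deriveZ k (@is_deriveV _ id t _ _ t0 (is_derive_id t (1 : R))).
apply: is_derive_eq d _.
have sc (p q : R) : p *: q = p * q by [].
by rewrite !sc /= mulr1 mulrN mulNr.
Qed.

Lemma is_derive_inv2 {R : realType} (k t : R) : t != 0 ->
  is_derive t (1 : R) (fun s => k * s ^- 2) (- 2 * k * t ^- 3).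
Proof.
move=> t0.
have t20 : t * t != 0 by rewrite mulf_neq0.
have dd := is_deriveM (is_derive_id t (1 : R)) (is_derive_id t (1 : R)).
have d := is_deriveZ k (@is_deriveV _ ((id : R -> R) * (id : R -> R)) t _ _ t20 dd).
have sc (p q : R) : p *: q = p * q by [].
have -> : (fun s : R => k * s ^- 2) = k \*: (fun y => ((id * id : R -> R) y)^-1).
  by apply/funext => s /=; rewrite sc.
apply: is_derive_eq d _.
rewrite !sc /=; have -> : (id * id : R -> R) t = t * t by [].
by field.
Qed.

(* Hopf's argument: a disc of the z-plane in the complement of the set {phi = m}
   touches it at some point; near this point phi + h / dist2 would have an interior
   maximum, although 1 / dist2 is strictly subharmonic. *)
Lemma patch_max_open {R : realType} (x y u v : R * R -> R) (A b c m : R)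
    (a : R * R) : complex_patch x y u v ->
  (forall a', quad A b c (u a') (v a') <= m) -> quad A b c (u a) (v a) = m ->
  \forall a' \near a, quad A b c (u a') (v a') = m.
Proof.
move=> P le_m am.
have [[tx ty] [tu tv] _ _] := P.
have [cx cy] := (twice_diff_continuous tx, twice_diff_continuous ty).
have cf : continuous (fun a' => quad A b c (u a') (v a')).
  by apply: continuous_quad; exact: twice_diff_continuous.
set f := (fun a' => quad A b c (u a') (v a')) in cf le_m am *.
have [k [r [k0 r0 hk]]] := patch_expand a P.
set d := k * r / 8.
have d0 : 0 < d by rewrite divr_gt0// mulr_gt0.
have krd : k * r = 8 * d by rewrite /d; field.
set N := [set a' | `|a' - a| <= r].
have cN : compact N := @compact_box _ a r.
have Na : N a by rewrite /N/= subrr normr0 ltW.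
apply: contrapT => hn.
have [a0 [Na0 xa0 ya0 fa0]] : exists a0,
    [/\ N a0, `|x a0 - x a| < d, `|y a0 - y a| < d & f a0 <> m].
  apply: contrapT => h; apply: hn.
  have nN : nbhs a N.
    have aa : `|a - a| < r by rewrite subrr normr0.
    by apply: filterS (near_norm_lt aa) => a' /ltW.
  have nx : \forall a' \near a, `|x a' - x a| < d.
    by have /cvgrPdist_lt/(_ _ d0) := cx a; apply: filterS => a'; rewrite distrC.
  have ny : \forall a' \near a, `|y a' - y a| < d.
    by have /cvgrPdist_lt/(_ _ d0) := cy a; apply: filterS => a'; rewrite distrC.
  near=> a'; apply: contrapT => fa'; apply: h; exists a'; split=> //.
  - by near: a'.
  - by near: a'.
  - by near: a'.
pose q a' := dist2 (x a0) (y a0) (x a') (y a').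
have cq : continuous q by exact: continuous_dist2.
have subc (B : set (R * R)) : closed B -> compact (N `&` B).
  by move=> cB; exact: compact_closedI.
(* [a2] is a point of {f = m} whose z is nearest to that of [a0]; this is where the disc touches the
   set. *)
have [|||a2] := @compact_EVT_min _ _ q (N `&` [set a' | f a' = m]).
- by exists a.
- apply: subc; apply: (@closed_comp _ _ f [set m]); last exact: closed_eq.
  by move=> a' _; exact: cf.
- exact: continuous_subspaceT.
rewrite inE => -[Na2 fa2] q2min.
have q2d : q a2 < 2 * d ^+ 2.
  apply: (@le_lt_trans _ _ (q a)); first by apply: q2min; rewrite inE.
  by apply: dist2_lt; rewrite distrC.
set s := q a2 in q2min q2d.
have s0 : 0 < s.
  rewrite lt_neqAle addr_ge0 ?sqr_ge0// andbT eq_sym; apply/eqP => /eqP.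
  rewrite /s /q /dist2 paddr_eq0 ?sqr_ge0// !sqrf_eq0 !subr_eq0 => /andP[/eqP xe /eqP ye].
  have := hk _ _ Na2 Na0; rewrite xe ye !subrr !normr0 addr0 pmulr_rle0// normr_le0 subr_eq0.
  by move=> /eqP e; apply: fa0; rewrite -e.
have s4 : s / 4 <= s by move: s0; clear; lra.
have [|||a4] := @compact_EVT_max _ _ f (N `&` [set a' | q a' <= s / 4]).
- exists a0; split=> //=; rewrite /q /dist2 !subrr expr0n /= addr0.
  by rewrite divr_ge0// ltW.
- apply: subc; apply: (@closed_comp _ _ q [set t | t <= s / 4]).
    by move=> a' _; exact: cq.
  exact: closed_le.
- exact: continuous_subspaceT.
rewrite inE => -[Na4 /= q4] f4max.
have f4 : f a4 < m.
  rewrite lt_neqAle le_m andbT; apply/eqP => f4m.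
  have : s <= q a4 by apply: q2min; rewrite inE.
  by move: q4 s0; clear; lra.
(* With this [h], the term [h / q] equals [m - f a4] on the inner circle [q = s / 4]. There
   [f + h / q] is at most [m], below its value [m + h / s] at [a2]. *)
pose h := s * (m - f a4) / 4.
have h0 : 0 < h by rewrite divr_gt0// mulr_gt0// subr_gt0.
pose g t := (- h) * t^-1.
have [|||a3] := @compact_EVT_max _ _ (fun a' => f a' - g (q a')) (N `&` [set a' | s / 4 <= q a']).
- by exists a2; split.
- apply: subc; apply: (@closed_comp _ _ q [set t | s / 4 <= t]).
    by move=> a' _; exact: cq.
  exact: closed_ge.
- apply: continuous_in_subspaceT => a'; rewrite inE => -[_ /= qa'].
  apply: cvgB; first exact: cf.
  apply: cvgM; first exact: cvg_cst.
  apply: cvgV; last exact: cq.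
  by rewrite gt_eqF// (lt_le_trans _ qa')// divr_gt0.
rewrite inE => -[Na3 /= q3] f3max.
have f32 : m + h / s <= f a3 + h / q a3.
  have := f3max a2; rewrite inE -/s fa2 /g !mulNr !opprK; apply.
  by split.
have q30 : 0 < q a3 by rewrite (lt_le_trans _ q3)// divr_gt0.
have q3s : s / 4 < q a3.
  rewrite lt_neqAle q3 andbT; apply/eqP => q3E.
  have f34 : f a3 <= f a4 by apply: f4max; rewrite inE; split=> //=; rewrite -q3E.
  move: f32; rewrite -q3E.
  have -> : h / (s / 4) = m - f a4 by rewrite /h; field; rewrite gt_eqF.
  have : 0 < h / s by rewrite divr_gt0.
  by move: f34; clear; lra.
(* On the edge of the box the choice of [d] gives [q > s], so that [f + h / q] is again below its
   value at [a2]. *)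
have r3 : `|a3 - a| < r.
  rewrite lt_neqAle Na3 andbT; apply/eqP => rE.
  have : s < q a3.
    have : 6 * d <= `|x a3 - x a0| + `|y a3 - y a0|.
      have := hk _ _ Na3 Na; rewrite rE => h1.
      have hx := ler_distD (x a0) (x a3) (x a); have hy := ler_distD (y a0) (y a3) (y a).
      move: h1 hx hy xa0 ya0 krd; clear.
      move: `|x a3 - x a| `|y a3 - y a| `|x a3 - x a0| `|x a0 - x a|
        `|y a3 - y a0| `|y a0 - y a| (k * r) d.
      by move=> *; lra.
    move/(dist2_ge (mulr_ge0 (ler0n _ 6) (ltW d0))); rewrite -/(q a3).
    have : 0 < d ^+ 2 by rewrite exprn_gt0.
    have -> : (6 * d) ^+ 2 = 36 * d ^+ 2 by ring.
    by move: q2d; clear; lra.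
  move=> sq; have : h / q a3 < h / s by rewrite ltr_pM2l// ltf_pV2.
  move=> hq; have := le_lt_trans f32 (ler_ltD (le_m a3) hq).
  by rewrite ltxx.
have dg : \forall t \near q a3, is_derive t (1 : R) g (h * t ^- 2).
  apply: filterS (lt_nbhsr q30) => t /lt0r_neq0 t0.
  by apply: is_derive_eq (is_derive_inv (- h) t0) _; rewrite opprK.
apply: (patch_no_max P dg (is_derive_inv2 h (lt0r_neq0 q30))).
  rewrite -/(q a3).
  have -> : q a3 * (- 2 * h * q a3 ^- 3) + h * q a3 ^- 2 = - (h / q a3 ^+ 2).
    by field; rewrite gt_eqF.
  by rewrite oppr_lt0 divr_gt0// exprn_gt0.
have n1 := near_norm_lt r3.
have n2 : \forall a' \near a3, s / 4 < q a' by exact: (cvgr_gt (q a3) (cq a3)).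
apply: filterS2 n1 n2 => a' n1 n2; apply: f3max; rewrite inE; split=> /=;
  exact: ltW.
Unshelve. all: by end_near. Qed.

(** [2 * A * v + c] and [b - 2 * A * u] are the partial derivatives of [quad]; up to sign they are
    the imaginary and real parts of the derivative of [- A w^2 + (b - i c) w]. As this derivative
    does not vanish, constancy of [phi] forces that of w. *)
Lemma patch_max_const {R : realType} (x y u v : R * R -> R) (A b c m : R)
    (a0 : R * R) : complex_patch x y u v ->
  (forall a, 2 * A * v a + c != 0 \/ b - 2 * A * u a != 0) ->
  (forall a, quad A b c (u a) (v a) <= m) -> quad A b c (u a0) (v a0) = m ->
  forall a, u a = u a0 /\ v a = v a0.
Proof.
move=> P nd le_m a0m.
have [[tx ty] [tu tv] ct _] := P.
have all_m a : quad A b c (u a) (v a) = m.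
  apply: (@clopen_all _ _ [set a | quad A b c (u a) (v a) = m]).
  - by exists a0.
  - apply: (@closed_comp _ _ (fun a => quad A b c (u a) (v a)) [set m]);
      last exact: closed_eq.
    by move=> a' _; apply: continuous_quad; exact: twice_diff_continuous.
  - by move=> a' a'm; exact: patch_max_open P le_m a'm.
have D0 a : (forall e, 'D_e u a = 0) /\ (forall e, 'D_e v a = 0).
  have [e1 [e2 [x1 y1 x2 y2 eE]]] := patch_frame a P.
  have d1 : \forall t \near dist2 0 0 (x a) (y a), is_derive t (1 : R) (cst 0 : R -> R) (cst 0 t).
    by apply: filterE => t; exact: is_derive_cst.
  have lm : \forall a' \near a, quad A b c (u a') (v a') - cst 0 (dist2 0 0 (x a') (y a')) <=
      quad A b c (u a) (v a) - cst 0 (dist2 0 0 (x a) (y a)).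
    by apply: filterE => a'; rewrite /= !all_m.
  have L e := (line_at_max e tx ty tu tv d1 (is_derive_cst 0 _ _) lm).1.
  have := L e1; have := L e2; have := ct a e1 e2; rewrite /= !mul0r !subr0 x1 x2 y1 y2.
  set p := 2 * A * v a + c in L nd *; set q := b - 2 * A * u a in L nd *.
  have : p != 0 \/ q != 0 by exact: nd.
  set u1 := 'D_e1 u a; set v1 := 'D_e1 v a; set u2 := 'D_e2 u a; set v2 := 'D_e2 v a.
  move=> npq [c1 c2] L2 L1.
  (* By the Cauchy-Riemann equations, the two first order conditions are a linear system in [u1] and
     [v1] with determinant [p ^+ 2 + q ^+ 2] up to sign. *)
  have pq0 : p ^+ 2 + q ^+ 2 != 0.
    by rewrite paddr_eq0 ?sqr_ge0// !sqrf_eq0 negb_and; apply/orP.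
  have u2E : u2 = - v1 by move: c1; clear; lra.
  have v2E : v2 = u1 by move: c2; clear; lra.
  have u10 : u1 = 0.
    apply: (mulfI pq0); rewrite mulr0.
    have -> : (p ^+ 2 + q ^+ 2) * u1 = p * (p * u1 + q * (- v1)) + q * (p * v1 + q * u1) by ring.
    by rewrite -{1}v2E -u2E L1 L2 !mulr0 addr0.
  have v10 : v1 = 0.
    apply: (mulfI pq0); rewrite mulr0.
    have -> : (p ^+ 2 + q ^+ 2) * v1 = p * (p * v1 + q * u1) - q * (p * u1 + q * (- v1)) by ring.
    by rewrite -[X in _ - q * (p * X + _)]v2E -u2E L1 L2 !mulr0 subr0.
  have lin (f : R * R -> R) : twice_diff f -> 'D_e1 f a = 0 -> 'D_e2 f a = 0 ->
      forall e, 'D_e f a = 0.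
    move=> [df _] h1 h2 e.
    by rewrite deriveE// (eE e) linearD/= !linearZ/= -!deriveE// h1 h2 !scaler0 addr0.
  split; apply: lin => //; first by rewrite -/u2 u2E v10 oppr0.
  by rewrite -/v2 v2E u10.
have const (f : R * R -> R) a : twice_diff f -> (forall a e, 'D_e f a = 0) -> f a = f a0.
  move=> [df _] D.
  have := @is_derive_0_is_cst _ (fun s : R => f (a0 + s *: (a - a0))) 1 0.
  have aE : a0 + (a - a0) = a by rewrite addrC subrK.
  rewrite scale1r scale0r addr0 aE; apply => s.
  by rewrite -(D (a0 + s *: (a - a0)) (a - a0)); exact: is_derive_line.
by move=> a; split; apply: const => // a' e; have [] := D0 a'.
Qed.

(** * Charts in real coordinates *)

Section ComplexTopology.
Context {R : realType}.

Lemma normc_lt (z : R[i]) (e : R) :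
  `|z| < e%:C%C -> `|complex.Re z| < e /\ `|complex.Im z| < e.
Proof.
rewrite normc_def ltcR => h.
have hle (t s : R) : `|t| <= Num.sqrt (t ^+ 2 + s ^+ 2).
  by rewrite -sqrtr_sqr ler_wsqrtr// lerDl sqr_ge0.
split; apply: le_lt_trans h; first exact: hle.
by rewrite addrC; exact: hle.
Qed.

Lemma normc_le (z : R[i]) : `|z| <= (`|complex.Re z| + `|complex.Im z|)%:C%C.
Proof.
rewrite normc_def lecR.
rewrite -[leRHS]ger0_norm ?addr_ge0// -sqrtr_sqr ler_wsqrtr//.
rewrite sqrrD !real_normK ?num_real// addrAC lerDl.
by rewrite mulrn_wge0// mulr_ge0.
Qed.

Lemma continuous_Re : continuous (fun z : C R => complex.Re z : R).
Proof.
move=> z A /nbhs_ballP[e /= e0 hA]; apply/nbhs_ballP.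
exists (e%:C)%C; first by rewrite /= ltcR.
move=> w; rewrite /ball/= => /normc_lt[hr _]; apply: hA.
by rewrite /ball/= -raddfB.
Qed.

Lemma continuous_Im : continuous (fun z : C R => complex.Im z : R).
Proof.
move=> z A /nbhs_ballP[e /= e0 hA]; apply/nbhs_ballP.
exists (e%:C)%C; first by rewrite /= ltcR.
move=> w; rewrite /ball/= => /normc_lt[_ hr]; apply: hA.
by rewrite /ball/= -raddfB.
Qed.

Lemma continuous_complex {T : topologicalType} (f g : T -> R) :
  continuous f -> continuous g -> continuous (fun t => (f t +i* g t)%C : C R).
Proof.
move=> cf cg t; apply/cvgrPdist_lt => e e0.
have [eR eR0 eE] : exists2 r : R, 0 < r & e = (r%:C)%C.
  exists (complex.Re e); move: e0; rewrite ltcE /= => /andP[/eqP ei er] //.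
  by case: e ei er => a b /= ->.
have e2 : 0 < eR / 2 by rewrite divr_gt0.
have /cvgrPdist_lt/(_ _ e2) hf := cf t.
have /cvgrPdist_lt/(_ _ e2) hg := cg t.
apply: filterS2 hf hg => s hf hg; rewrite eE.
apply: le_lt_trans (normc_le _) _; rewrite ltcR /= (splitr eR).
exact: ltrD.
Qed.

Lemma continuous_pair {T U V : topologicalType} (f : T -> U) (g : T -> V) :
  continuous f -> continuous g -> continuous (fun t => (f t, g t)).
Proof. by move=> cf cg t; apply: cvg_pair; [exact: cf|exact: cg]. Qed.

Lemma continuous_comp2 {T U V : topologicalType} (f : T -> U) (g : U -> V) :
  continuous f -> continuous g -> continuous (g \o f).
Proof. by move=> cf cg t; apply: continuous_comp; [exact: cf|exact: cg]. Qed.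

Lemma coordsK : cancel (@coords R) of_coords.
Proof. by case=> -[a b] [c d]. Qed.

Lemma continuous_coords : continuous (@coords R).
Proof.
have c1 : continuous (fun p : C2 R => p.1) by move=> p; exact: cvg_fst.
have c2 : continuous (fun p : C2 R => p.2) by move=> p; exact: cvg_snd.
exact: (continuous_pair (continuous_pair (continuous_pair
  (continuous_comp2 c1 continuous_Re) (continuous_comp2 c1 continuous_Im))
  (continuous_comp2 c2 continuous_Re)) (continuous_comp2 c2 continuous_Im)).
Qed.

Lemma continuous_of_coords : continuous (@of_coords R).
Proof.
have c1 : continuous (fun a : R * R * R * R => a.1) by move=> a; exact: cvg_fst.
have c2 : continuous (fun a : R * R * R => a.1) by move=> a; exact: cvg_fst.
have c3 : continuous (fun a : R * R => a.1) by move=> a; exact: cvg_fst.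
have d1 : continuous (fun a : R * R * R * R => a.2) by move=> a; exact: cvg_snd.
have d2 : continuous (fun a : R * R * R => a.2) by move=> a; exact: cvg_snd.
have d3 : continuous (fun a : R * R => a.2) by move=> a; exact: cvg_snd.
have e1 := continuous_comp2 c1 c2.
exact: (continuous_pair
  (continuous_complex (continuous_comp2 e1 c3) (continuous_comp2 e1 d3))
  (continuous_complex (continuous_comp2 c1 d2) d1)).
Qed.

End ComplexTopology.

Lemma twice_diff_Ck {R : realType} {V W : normedModType R} (f : V -> W) :
  smooth f -> twice_diff f.
Proof. by move=> /(_ 2)[df ddf]; split=> // e a; case: (ddf e) => + _; apply. Qed.

Section Linear.
Context {R : realType} {V W X : normedModType R}.

Lemma derive_linear (l : {linear W -> X}) (f : V -> W) (a e : V) :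
  continuous l -> differentiable f a -> 'D_e (l \o f) a = l ('D_e f a).
Proof.
move=> cl df; have dl : differentiable l (f a) by exact: linear_differentiable.
by rewrite !deriveE//; [rewrite diff_comp//= diff_lin|exact: differentiable_comp].
Qed.

Lemma twice_diff_linear (l : {linear W -> X}) (f : V -> W) :
  continuous l -> twice_diff f -> twice_diff (l \o f).
Proof.
move=> cl [df ddf].
have dl a : differentiable l a by exact: linear_differentiable.
split=> [a|e a]; first exact: differentiable_comp.
have -> : 'D_e (l \o f) = l \o 'D_e f.
  by apply/funext => b; exact: derive_linear.
exact: differentiable_comp.
Qed.

End Linear.

Section Slice.
Context {R : realType} {V W X : normedModType R}.

Lemma derive_slice (f : V * W -> X) (a e : V) (t : W) :
  'D_e (fun a => f (a, t)) a = 'D_((e, 0) : V * W) f (a, t).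
Proof.
have E : (fun h : R => h^-1 *: (((fun a => f (a, t)) \o shift a) (h *: e) - f (a, t)))
  = (fun h : R => h^-1 *: ((f \o shift (a, t)) (h *: ((e, 0) : V * W)) - f (a, t))).
  apply/funext => h /=.
  have -> : h *: ((e, 0) : V * W) + (a, t) = (h *: e + a, t).
    by apply/pair_equal_spec; split=> //=; rewrite scaler0 add0r.
  by [].
by rewrite /derive E.
Qed.

Lemma twice_diff_slice (f : V * W -> X) (t : W) :
  twice_diff f -> twice_diff (fun a => f (a, t)).
Proof.
have di a : differentiable (fun a : V => (a, t) : V * W) a.
  exact: (@differentiable_pair _ _ _ _ id (cst t)).
move=> [df ddf]; split=> [a|e a].
  exact: (@differentiable_comp _ _ _ _ (fun a : V => (a, t) : V * W) f).
have -> : 'D_e (fun a => f (a, t)) =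
    'D_((e, 0) : V * W) f \o (fun a : V => (a, t) : V * W).
  by apply/funext => b; exact: derive_slice.
exact: differentiable_comp.
Qed.

End Slice.

(** The equations are the real and imaginary parts of [(p + i q) (X + i Y) = (P + i Q) (x + i y)],
    whose right-hand side is zero. *)
Lemma wedge_inj {R : realType} (p q X Y P Q x y : R) :
  X != 0 \/ Y != 0 -> x = 0 -> y = 0 ->
  p * X - q * Y = P * x - Q * y -> p * Y + q * X = P * y + Q * x ->
  p = 0 /\ q = 0.
Proof.
move=> XY -> ->; rewrite !mulr0 subr0 addr0 => h1 h2.
have XY0 : X ^+ 2 + Y ^+ 2 != 0.
  by rewrite paddr_eq0 ?sqr_ge0// !sqrf_eq0 negb_and; apply/orP.
split; apply: (mulfI XY0); rewrite mulr0.
  have -> : (X ^+ 2 + Y ^+ 2) * p = X * (p * X - q * Y) + Y * (p * Y + q * X) by ring.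
  by rewrite h1 h2 !mulr0 addr0.
have -> : (X ^+ 2 + Y ^+ 2) * q = X * (p * Y + q * X) - Y * (p * X - q * Y) by ring.
by rewrite h1 h2 !mulr0 subr0.
Qed.

Lemma derive_triple {R : realType} {V : normedModType R} (h : R * R * R -> R)
    (f1 f2 f3 : V -> R) (a e : V) : (forall b, differentiable h b) ->
  differentiable f1 a -> differentiable f2 a -> differentiable f3 a ->
  'D_e (fun b => h (f1 b, f2 b, f3 b)) a =
  'd h (f1 a, f2 a, f3 a) ('D_e f1 a, 'D_e f2 a, 'D_e f3 a).
Proof.
move=> dh d1 d2 d3.
have d12 : differentiable (fun b => (f1 b, f2 b)) a by exact: differentiable_pair.
have d123 : differentiable (fun b => (f1 b, f2 b, f3 b)) a.
  exact: differentiable_pair.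
rewrite !deriveE//; last exact: (differentiable_comp d123).
rewrite (diff_comp d123 (dh _)) /= (diff_pair d12 d3) (diff_pair d1 d2).
by [].
Qed.

Section Chart.
Context {R : realType}.
Implicit Types (psi : R * R * R -> C2 R) (p : C2 R).

Definition cx p : R := complex.Re p.1.
Definition cy p : R := complex.Im p.1.
Definition cu p : R := complex.Re p.2.
Definition cv p : R := complex.Im p.2.

Lemma continuous_cx : continuous cx.
Proof. by apply: (continuous_comp2 _ continuous_Re) => p; exact: cvg_fst. Qed.

Lemma continuous_cy : continuous cy.
Proof. by apply: (continuous_comp2 _ continuous_Im) => p; exact: cvg_fst. Qed.

Lemma continuous_cu : continuous cu.
Proof. by apply: (continuous_comp2 _ continuous_Re) => p; exact: cvg_snd. Qed.

Lemma continuous_cv : continuous cv.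
Proof. by apply: (continuous_comp2 _ continuous_Im) => p; exact: cvg_snd. Qed.

Let F1 := (fst \o fst \o fst : {linear (R * R * R * R)%type -> R}).
Let F2 := (snd \o fst \o fst : {linear (R * R * R * R)%type -> R}).
Let F3 := (snd \o fst : {linear (R * R * R * R)%type -> R}).
Let F4 := (snd : {linear (R * R * R * R)%type -> R}).

Let cfst {V W : normedModType R} : continuous (fst : V * W -> V).
Proof. by move=> a; exact: cvg_fst. Qed.

Let csnd {V W : normedModType R} : continuous (snd : V * W -> W).
Proof. by move=> a; exact: cvg_snd. Qed.

Let cF1 : continuous F1.
Proof. exact: (continuous_comp2 (continuous_comp2 cfst cfst) cfst). Qed.
Let cF2 : continuous F2.
Proof. exact: (continuous_comp2 (continuous_comp2 cfst cfst) csnd). Qed.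
Let cF3 : continuous F3.
Proof. exact: (continuous_comp2 cfst csnd). Qed.
Let cF4 : continuous F4.
Proof. exact: csnd. Qed.

Section ChartComponents.
Context {V : normedModType R} (psi : V -> C2 R) (spsi : smooth (coords \o psi)).

Lemma chart_twice_diff : [/\ twice_diff (cx \o psi), twice_diff (cy \o psi),
  twice_diff (cu \o psi) & twice_diff (cv \o psi)].
Proof.
have t := twice_diff_Ck spsi.
split.
- exact: (twice_diff_linear cF1 t).
- exact: (twice_diff_linear cF2 t).
- exact: (twice_diff_linear cF3 t).
- exact: (twice_diff_linear cF4 t).
Qed.

Lemma chart_diff (b e : V) : 'd (coords \o psi) b e =
  ('D_e (cx \o psi) b, 'D_e (cy \o psi) b, 'D_e (cu \o psi) b, 'D_e (cv \o psi) b).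
Proof.
have [d _] := twice_diff_Ck spsi.
rewrite -deriveE//; set D := 'D_e (coords \o psi) b.
have -> : 'D_e (cx \o psi) b = F1 D by rewrite -(derive_linear _ cF1).
have -> : 'D_e (cy \o psi) b = F2 D by rewrite -(derive_linear _ cF2).
have -> : 'D_e (cu \o psi) b = F3 D by rewrite -(derive_linear _ cF3).
have -> : 'D_e (cv \o psi) b = F4 D by rewrite -(derive_linear _ cF4).
by case: D => [[[? ?] ?] ?].
Qed.

Lemma chart_continuous : continuous psi.
Proof.
have -> : psi = of_coords \o (coords \o psi).
  by apply/funext => a /=; rewrite coordsK.
apply: (continuous_comp2 _ continuous_of_coords).
exact: twice_diff_continuous (twice_diff_Ck spsi).
Qed.

End ChartComponents.

(* Stated as dw /\ dz = 0 on the tangent plane of the plaque rather than with a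
   slope, in order to pass to limits of leaves. *)
Definition complex_tangent psi (b : R * R * R) : Prop :=
  forall e1 e2 : R * R,
  let D e f := 'D_((e, 0) : R * R * R) (f \o psi) b in
  D e1 cu * D e2 cx - D e1 cv * D e2 cy = D e2 cu * D e1 cx - D e2 cv * D e1 cy /\
  D e1 cu * D e2 cy + D e1 cv * D e2 cx = D e2 cu * D e1 cy + D e2 cv * D e1 cx.

Lemma closed_complex_tangent psi : smooth (coords \o psi) ->
  closed (complex_tangent psi).
Proof.
move=> spsi; have [tx ty tu tv] := chart_twice_diff spsi.
have -> : complex_tangent psi = \bigcap_(e in [set: (R * R) * (R * R)])
  ([set b | 'D_((e.1, 0) : R * R * R) (cu \o psi) b * 'D_((e.2, 0) : R * R * R) (cx \o psi) b
    - 'D_((e.1, 0) : R * R * R) (cv \o psi) b * 'D_((e.2, 0) : R * R * R) (cy \o psi) b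
    - ('D_((e.2, 0) : R * R * R) (cu \o psi) b * 'D_((e.1, 0) : R * R * R) (cx \o psi) b
    - 'D_((e.2, 0) : R * R * R) (cv \o psi) b * 'D_((e.1, 0) : R * R * R) (cy \o psi) b) = 0] `&`
  [set b | 'D_((e.1, 0) : R * R * R) (cu \o psi) b * 'D_((e.2, 0) : R * R * R) (cy \o psi) b
    + 'D_((e.1, 0) : R * R * R) (cv \o psi) b * 'D_((e.2, 0) : R * R * R) (cx \o psi) b
    - ('D_((e.2, 0) : R * R * R) (cu \o psi) b * 'D_((e.1, 0) : R * R * R) (cy \o psi) b
    + 'D_((e.2, 0) : R * R * R) (cv \o psi) b * 'D_((e.1, 0) : R * R * R) (cx \o psi) b) = 0]).
  apply/seteqP; split=> b.
    by move=> h [e1 e2] _; have [h1 h2] := h e1 e2; split=> /=; apply/subr0_eq; rewrite subr0;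
      apply/eqP; rewrite subr_eq0; apply/eqP.
  by move=> h e1 e2; have [h1 h2] := h (e1, e2) I; split; exact/subr0_eq.
apply: closed_bigI => e _.
have cd (f : R * R * R -> R) e' : twice_diff f -> continuous ('D_e' f).
  by move=> [_ df] b; exact: differentiable_continuous.
have cM (f g : R * R * R -> R) : continuous f -> continuous g ->
  continuous (fun b => f b * g b) by move=> cf cg b; apply: cvgM; [exact: cf|exact: cg].
have cD (f g : R * R * R -> R) : continuous f -> continuous g ->
  continuous (fun b => f b + g b) by move=> cf cg b; apply: cvgD; [exact: cf|exact: cg].
have cB (f g : R * R * R -> R) : continuous f -> continuous g ->
  continuous (fun b => f b - g b) by move=> cf cg b; apply: cvgB; [exact: cf|exact: cg].
have cl (f : R * R * R -> R) : continuous f -> closed [set b | f b = 0].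
  by move=> cf; apply: (@closed_comp _ _ f [set 0]) => [b _|];
    [exact: cf|exact: closed_eq].
apply: closedI; apply: (cl); apply: (cB).
- by apply: (cB); apply: (cM); exact: cd.
- by apply: (cB); apply: (cM); exact: cd.
- by apply: (cD); apply: (cM); exact: cd.
- by apply: (cD); apply: (cM); exact: cd.
Qed.

(** The point is that z is a local coordinate on a complex plaque. If [dz] is nonzero somewhere on
    the tangent plane, its kernel is also killed by [dw], so it is trivial. A vertical plane {dz =
    0} is impossible on a graph over (z, u): [dv] would be a multiple of [du] there, leaving a
    single real direction. *)
Lemma chart_patch (rho : C R * R -> R) psi (t : R) :
  smooth (fun a : R * R * R => rho ((a.1.1 +i* a.1.2)%C, a.2)) ->
  smooth_embedding psi -> range psi `<=` graph rho ->
  (forall a, complex_tangent psi (a, t)) ->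
  complex_patch (fun a => cx (psi (a, t))) (fun a => cy (psi (a, t)))
    (fun a => cu (psi (a, t))) (fun a => cv (psi (a, t))).
Proof.
move=> /twice_diff_Ck[drho _] [spsi imm _ _] gpsi ct.
have [tx ty tu tv] := chart_twice_diff spsi.
split.
- by split; [exact: (twice_diff_slice t tx)|exact: (twice_diff_slice t ty)].
- by split; [exact: (twice_diff_slice t tu)|exact: (twice_diff_slice t tv)].
- move=> a e1 e2; have := ct a e1 e2.
  by rewrite /= -!derive_slice.
move=> a e; rewrite (derive_slice (cx \o psi)) (derive_slice (cy \o psi)) => xe ye.
pose D (e : R * R) (f : C2 R -> R) : R := 'D_((e, 0) : R * R * R) (f \o psi) (a, t).
have DD (e' : R * R) (k : R) (f : C2 R -> R) : twice_diff (f \o psi) -> D (k *: e') f = k * D e' f.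
  move=> [df _]; rewrite /D !deriveE//.
  have -> : (k *: e', 0) = k *: ((e', 0) : R * R * R).
    by apply/pair_equal_spec; split=> //=; rewrite scaler0.
  by rewrite linearZ.
have DB (e' e'' : R * R) (f : C2 R -> R) : twice_diff (f \o psi) -> D (e' + e'') f = D e' f + D e'' f.
  move=> [df _]; rewrite /D !deriveE// -linearD/=; congr ('d _ _ _).
  by apply/pair_equal_spec; split=> //=; rewrite addr0.
have inj (e' : R * R) : D e' cx = 0 -> D e' cy = 0 -> D e' cu = 0 -> D e' cv = 0 -> e' = 0.
  move=> h1 h2 h3 h4; have := imm (a, t) (e', 0).
  rewrite chart_diff// -!/(D _ _) h1 h2 h3 h4 => /(_ erefl).
  by case/pair_equal_spec.
have [[f fxy]|none] := pselect (exists f, D f cx != 0 \/ D f cy != 0).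
  have [h1 h2] := ct a e f.
  have [ue ve] := wedge_inj fxy xe ye h1 h2.
  exact: (inj e xe ye ue ve).
have x0 f : D f cx = 0.
  by apply: contrapT => /eqP h; apply: none; exists f; left.
have y0 f : D f cy = 0.
  by apply: contrapT => /eqP h; apply: none; exists f; right.
pose r3 := fun a : R * R * R => rho ((a.1.1 +i* a.1.2)%C, a.2).
(* [k] is the partial derivative of [rho] in u. *)
pose k := 'd r3 (cx (psi (a, t)), cy (psi (a, t)), cu (psi (a, t))) (0, 0, 1).
have vE f : D f cv = D f cu * k.
  have E : cv \o psi = fun b => r3 ((cx \o psi) b, (cy \o psi) b, (cu \o psi) b).
    apply/funext => b; have := gpsi (psi b) (imageT _ _).
    rewrite /graph /= /cv => ->; rewrite /r3 /= /cx /cy.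
    by case: (psi b).1.
  have -> : D f cv = 'd r3 (cx (psi (a, t)), cy (psi (a, t)), cu (psi (a, t)))
      (D f cx, D f cy, D f cu).
    by rewrite {1}/D E; apply: derive_triple;
      [exact: drho|exact: tx.1|exact: ty.1|exact: tu.1].
  rewrite x0 y0 /k; move: (D f cu) => c.
  have -> : (0, 0, c) = c *: ((0, 0, 1) : R * R * R).
    apply/pair_equal_spec; split; last by rewrite /= [_ *: 1]mulr1.
    by apply/pair_equal_spec; split; rewrite /= scaler0.
  by rewrite linearZ.
have ker f : D f cu = 0 -> f = 0.
  by move=> uf; apply: (inj f (x0 f) (y0 f) uf); rewrite vE uf mul0r.
pose f1 : R * R := (1, 0); pose f2 : R * R := (0, 1).
have : D f2 cu *: f1 + (- D f1 cu) *: f2 = 0.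
  apply: ker; rewrite (DB _ _ _ tu) (DD _ _ _ tu) (DD _ _ _ tu).
  by move: (D f1 cu) (D f2 cu) => c d; ring.
case/pair_equal_spec; rewrite /= [_ *: 1]mulr1 [_ *: 0]mulr0 addr0 => /ker.
by case/pair_equal_spec => _ /eqP; rewrite oner_eq0.
Qed.

End Chart.

(** * Tangent planes of complex leaves *)

Lemma compact_box3 {R : realType} (r : R) : compact [set e : R * R * R | `|e| <= r].
Proof.
have -> : [set e : R * R * R | `|e| <= r] =
    [set b : R * R | `|b - 0| <= r] `*` `[(- r), r].
  have nE (b : R * R) (t : R) : (`|(b, t)| <= r) = (`|b| <= r) && (`|t| <= r).
    by rewrite -ge_max.
  apply/seteqP; split=> -[b t] /=; rewrite subr0 in_itv/= -ler_norml nE.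
    by move/andP.
  by move=> h; apply/andP.
by apply: compact_setX; [exact: compact_box|exact: segment_compact].
Qed.

Lemma linear_lower_bound {R : realType} {W : normedModType R}
    (l : {linear (R * R * R)%type -> W}) : continuous l ->
  (forall e, l e = 0 -> e = 0) ->
  exists2 k : R, 0 < k & forall e, k * `|e| <= `|l e|.
Proof.
move=> cl inj.
pose S := [set e : R * R * R | `|e| = 1].
have cS : compact S.
  have clS : closed S.
    apply: (@closed_comp _ _ (fun e : R * R * R => `|e|) [set 1]); last exact: closed_eq.
    by move=> e _; exact: norm_continuous.
  apply: (subclosed_compact clS (compact_box3 (r := 1))).
  by move=> e; rewrite /S/= => ->.
have [||e0] := @compact_EVT_min _ _ (fun e => `|l e|) S _ cS.
- exists (1, 0, 0).
  have nE : `|(1, 0, 0) : R * R * R| = Num.max (Num.max `|1 : R| `|0 : R|) `|0 : R| by [].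
  by rewrite /S/= nE normr1 normr0 !(max_idPl ler01).
- by apply: continuous_subspaceT => e; apply: continuous_comp; [exact: cl|exact: norm_continuous].
rewrite inE => e01 emin.
exists `|l e0|.
  rewrite normr_gt0; apply/eqP => /inj e00; move: e01; rewrite e00 /S/= normr0.
  by move/esym/eqP; rewrite oner_eq0.
move=> e; have [->|en0] := eqVneq e 0; first by rewrite normr0 mulr0.
have ne : 0 < `|e| by rewrite normr_gt0.
have : `|l e0| <= `|l (`|e|^-1 *: e)|.
  by apply: emin; rewrite inE /S/= normrZ normfV normr_id mulVf// gt_eqF.
by rewrite linearZ/= normrZ normfV normr_id mulrC ler_pdivlMr.
Qed.

Lemma plane_basis {R : realType} (e f : R * R) :
  (forall k m : R, k *: e + m *: f = 0 -> k = 0 /\ m = 0) ->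
  forall g, exists k m : R, g = k *: e + m *: f.
Proof.
move=> indep.
have [|||||h1 [h2 [a1 b1 a2 b2 _]]] := @plane_dual _
  (fun h : R * R => h.1 * e.1 + h.2 * f.1) (fun h : R * R => h.1 * e.2 + h.2 * f.2).
- by move=> k h /=; rewrite mulrDr !mulrA.
- by move=> k h /=; rewrite mulrDr !mulrA.
- by move=> h h' /=; ring.
- by move=> h h' /=; ring.
- move=> [k m] /= h1 h2; have [|-> -> //] := indep k m.
  by apply/pair_equal_spec.
move=> g; exists (g.1 * h1.1 + g.2 * h2.1), (g.1 * h1.2 + g.2 * h2.2).
rewrite [LHS]surjective_pairing; apply/pair_equal_spec; split=> /=.
  rewrite -[LHS]mulr1 -[X in _ * X]a1 -[LHS]addr0 -[X in _ + X](mulr0 g.2) -a2.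
  rewrite -[_ *: e.1]/(_ * e.1) -[_ *: f.1]/(_ * f.1); ring.
rewrite -[LHS]mulr1 -[X in _ * X]b2 -[LHS]addr0 -[X in _ + X](mulr0 g.1) -b1.
rewrite -[_ *: e.2]/(_ * e.2) -[_ *: f.2]/(_ * f.2); ring.
Qed.

(* A parametrization of a leaf need not lift continuously differentiably through
   psi; the difference quotients of its lift are nevertheless bounded, and
   compactness provides the preimage of its velocity. *)
Lemma tangent_of_curve {R : realType} (psi : R * R * R -> C2 R) (a : R * R)
    (t : R) (c : R -> C2 R) (w : R * R * R * R) :
  smooth_embedding psi -> c 0 = psi (a, t) -> {for 0, continuous c} ->
  (\forall s \near (0 : R), exists a', c s = psi (a', t)) ->
  s^-1 *: (coords (c s) - coords (c 0)) @[s --> (0 : R)^'] --> w ->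
  exists e : R * R, 'd (coords \o psi) (a, t) ((e, 0) : R * R * R) = w.
Proof.
move=> [spsi imm ipsi emb] c0 cc cpl cw.
have [dF _] := twice_diff_Ck spsi.
set F := coords \o psi in dF *.
set l := 'd F (a, t).
have cl : continuous l by exact: diff_continuous.
have [k k0 lk] := linear_lower_bound cl (imm (a, t)).
(* [M] bounds the quotients [e] of the lift: [k] times the norm of [e] is at most the norm of [w],
   plus 1, plus [k / 2] times the norm of [e]. *)
pose M := 2 / k * (`|w| + 1).
have M0 : 0 < M by rewrite mulr_gt0 ?divr_gt0// ltr_wpDl.
pose K := [set e : R * R * R | `|e| <= M] `&` [set e | e.2 = 0].
have clK : closed [set e : R * R * R | e.2 = 0].
  apply: (@closed_comp _ _ snd [set 0]); last exact: closed_eq.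
  by move=> e _; exact: cvg_snd.
have cK : compact K by exact: compact_closedI (compact_box3 (r := M)) clK.
have clLK : closed (l @` K).
  apply: compact_closed; first exact: norm_hausdorff.
  by apply: continuous_compact => //; exact: continuous_subspaceT.
suff : (l @` K) w by move=> [[e s]] [_ /= ->] <-; exists e.
apply: clLK => B /nbhs_normP[r /= r0 rB].
(* The first entry allows the linearization error to be absorbed in the bound [M]; the second makes
   this error at most [r / 2]. *)
pose eta := Num.min (k / 2) (r / (2 * M)).
have eta0 : 0 < eta by rewrite lt_min !divr_gt0// mulr_gt0.
have /nbhs_normP[d /= d0 hd] := differentiable_ler (dF (a, t)) eta0.
have nb : nbhs ((a, t) : R * R * R) [set b | `|b - (a, t)| < d].
  have aa : `|(a, t) - (a, t)| < d by rewrite subrr normr0.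
  exact: near_norm_lt aa.
(* Since [psi] is a homeomorphism onto its image, the parameters of [c s] are close to [(a, t)] as
   soon as [c s] is close to [c 0]. *)
have [Q nQ QU] := emb (a, t) _ nb.
have nOc : \forall s \near (0 : R)^', Q (c s).
  by apply: nbhs_dnbhs; apply: cc; rewrite c0.
have cpl' : \forall s \near (0 : R)^', exists a', c s = psi (a', t).
  exact: nbhs_dnbhs.
have r2 : 0 < Num.min (r / 2) 1 by rewrite lt_min divr_gt0//= ltr01.
have cw' : \forall s \near (0 : R)^',
    `|w - s^-1 *: (coords (c s) - coords (c 0))| < Num.min (r / 2) 1.
  by move/cvgrPdist_lt : cw; apply.
have [s [s0 Qs [a' csa'] ws]] : exists s : R, [/\ s != 0, Q (c s),
    (exists a', c s = psi (a', t)) &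
    `|w - s^-1 *: (coords (c s) - coords (c 0))| < Num.min (r / 2) 1].
  near (0 : R)^' => s; exists s; split.
  - by near: s; exact: nbhs_dnbhs_neq.
  - by near: s.
  - by near: s.
  - by near: s.
move: ws; rewrite lt_min c0 csa' -/(F _) -[coords (psi (a, t))]/(F (a, t)) => /andP[wr w1].
set h : R * R * R := (a', t) - (a, t).
have hd' : `|h| < d by apply: (QU (a', t)); rewrite /= -csa'.
have /hd /= : ball_ Num.norm 0 d h by rewrite /= sub0r normrN.
have hE : (a, t) + h = (a', t) by rewrite /h addrC subrK.
rewrite hE -/l => Fh.
set q := s^-1 *: (F (a', t) - F (a, t)) in wr w1 *.
pose e := s^-1 *: h.
have qe : `|q - l e| <= eta * `|e|.
  rewrite /q /e linearZ/= -scalerBr !normrZ mulrCA ler_wpM2l//.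
have q1 : `|q| <= `|w| + 1.
  rewrite -lerBlDl (le_trans _ (ltW w1))// distrC; exact: lerB_dist.
have eM : `|e| <= M.
  have h1 : k * `|e| <= `|q| + eta * `|e|.
    apply: (le_trans (lk e)); rewrite -lerBlDl (le_trans _ qe)// [leRHS]distrC.
    exact: lerB_dist.
  have h2 : eta * `|e| <= k / 2 * `|e| by rewrite ler_wpM2r// ge_min lexx.
  rewrite /M mulrAC ler_pdivlMr// .
  by move: h1 h2 q1; rewrite mulrC; move: (k * `|e|) => ke; move: `|q| `|w| `|e|; clear; move=> *; lra.
exists (l e); split.
  exists e => //; split=> //=; rewrite /e /h /=.
  by rewrite subrr scaler0.
apply: rB => /=; rewrite -(subrK q w) -addrA (le_lt_trans (ler_normD _ _))//.
rewrite (splitr r) ltr_leD// (le_trans qe)//.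
rewrite (@le_trans _ _ (r / (2 * M) * M))//.
  by rewrite ler_pM// ?(ltW eta0)// ge_min lexx orbT.
rewrite [leLHS](_ : _ = r / 2)//; field.
by rewrite gt_eqF.
Unshelve. all: by end_near. Qed.

Section ComplexCurve.
Context {R : realType}.

Lemma coords_scale (k : R) (p : C2 R) : coords ((k%:C)%C *: p) = k *: coords p.
Proof.
have sc (r s : R) : r *: s = r * s by [].
case: p => -[a b] [c d]; rewrite /coords /=.
by congr (_, _, _, _); rewrite /= ?mul0r ?subr0 ?addr0 ?sc ?add0r.
Qed.

Lemma coordsB (p q : C2 R) : coords (p - q) = coords p - coords q.
Proof.
case: p => -[a b] [c d]; case: q => -[a' b'] [c' d']; rewrite /coords /=.
by [].
Qed.

Lemma continuous_real_line (z h : C R) :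
  continuous (fun s : R => (z + (s%:C)%C * h : C R)).
Proof.
have -> : (fun s : R => (z + (s%:C)%C * h : C R)) =
  (fun s => ((complex.Re z + s * complex.Re h) +i* (complex.Im z + s * complex.Im h))%C).
  by apply/funext => s; case: z => a b; case: h => c d; apply/eqP;
    rewrite eq_complex /= !mul0r subr0 addr0 !eqxx.
have cl (p q : R) : continuous (fun s : R => p + s * q).
  by move=> s; apply: cvgD; [exact: cvg_cst|apply: cvgM; [exact: cvg_id|exact: cvg_cst]].
exact: continuous_complex.
Qed.

Lemma real_line_cvg (gam : C R -> C2 R) (z h : C R) :
  derivable gam z 1 -> h != 0 ->
  s^-1 *: (coords (gam (z + (s%:C)%C * h)) - coords (gam (z + (0%:C)%C * h)))
    @[s --> (0 : R)^'] --> coords (h *: 'D_1 gam z).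
Proof.
move=> dg h0.
pose Q (k : C R) : C2 R := k^-1 *: ((gam \o shift z) (k *: (1 : C R)) - gam z).
have cQ : Q k @[k --> (0 : C R)^'] --> 'D_1 gam z by exact: dg.
have cs : ((s%:C)%C * h : C R) @[s --> (0 : R)^'] --> (0 : C R)^'.
  move=> B nB.
  have nB0 : nbhs (0 + (0%:C)%C * h : C R) (fun k => k != 0 -> B k).
    by rewrite add0r mul0r; exact: nB.
  have nB1 : \forall s \near (0 : R), (0 + (s%:C)%C * h : C R) != 0 -> B (0 + (s%:C)%C * h).
    exact: (continuous_real_line nB0).
  rewrite /nbhs/= /dnbhs /within/=; apply: filterS nB1 => s; rewrite add0r => Bs s0; apply: Bs.
  by rewrite mulf_neq0// eq_complex /= eqxx andbT.
have cl : coords (h *: Q ((s%:C)%C * h)) @[s --> (0 : R)^'] --> coords (h *: 'D_1 gam z).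
  apply: (@cvg_comp _ _ _ (fun s : R => (s%:C)%C * h) (fun k => coords (h *: Q k)) _ _ _ cs).
  apply: (@cvg_comp _ _ _ (fun k : C R => h *: Q k) coords _ (nbhs (h *: 'D_1 gam z))); last exact: continuous_coords.
  exact: cvgZ (cvg_cst h) cQ.
apply: cvg_trans cl; apply: near_eq_cvg; near=> s.
have s0 : s != 0 by near: s; exact: nbhs_dnbhs_neq.
have sC0 : (s%:C)%C != 0 :> R[i] by rewrite eq_complex /= eqxx andbT.
rewrite -coordsB -coords_scale mul0r addr0; congr coords.
rewrite /Q scalerA invfM mulrCA divff// mulr1 /= [_ *: 1]mulr1 [z + _]addrC.
by congr (_ *: _); rewrite -fmorphV.
Unshelve. all: by end_near. Qed.

Lemma complex_derivable_continuous (gam : C R -> C2 R) (z : C R) :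
  derivable gam z 1 -> {for z, continuous gam}.
Proof. by move=> /derivable1_diffP /differentiable_continuous. Qed.

(** The velocities of [gam] in the directions 1 and i are [xi] and [i xi]. Both are tangent to the
    plaque and they are independent over the reals, so its tangent plane is the complex line spanned
    by [xi]. *)
Lemma complex_tangent_curve (psi : R * R * R -> C2 R) (a : R * R) (t : R)
    (gam : C R -> C2 R) (z : C R) :
  smooth_embedding psi -> gam z = psi (a, t) ->
  derivable gam z 1 -> 'D_1 gam z <> 0 ->
  (\forall k \near z, exists a', gam k = psi (a', t)) ->
  complex_tangent psi (a, t).
Proof.
move=> epsi gz dg xi0 pl; set xi := 'D_1 gam z in xi0.
have [spsi imm _ _] := epsi.
have [tx ty tu tv] := chart_twice_diff spsi.
have [dF _] := twice_diff_Ck spsi.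
have tan (h : C R) : h != 0 -> exists e : R * R,
    'd (coords \o psi) (a, t) ((e, 0) : R * R * R) = coords (h *: xi).
  move=> h0; pose c s := gam (z + (s%:C)%C * h).
  have z0 : z + (0%:C)%C * h = z by rewrite mul0r addr0.
  have c0 : c 0 = psi (a, t) by rewrite /c z0.
  have cc : {for 0, continuous c}.
    apply: (@continuous_comp _ _ _ (fun s : R => (z + (s%:C)%C * h : C R)) gam).
      exact: continuous_real_line.
    by rewrite z0; exact: complex_derivable_continuous.
  have cpl : \forall s \near (0 : R), exists a', c s = psi (a', t).
    have := @continuous_real_line z h 0; rewrite /continuous_at z0 => /(_ _ pl).
    by rewrite /nbhs/=.
  exact: tangent_of_curve epsi c0 cc cpl (real_line_cvg dg h0).
have i0 : 'i%C != 0 :> R[i] by rewrite eq_complex /= oner_eq0 andbF.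
have [e1 de1] := tan 1 (oner_neq0 _); have [e2 de2] := tan 'i%C i0.
rewrite scale1r in de1.
have D0 (e : R * R) : 'd (coords \o psi) (a, t) ((e, 0) : R * R * R) = 0 -> e = 0.
  by move=> /imm /pair_equal_spec[].
have lin (k m : R) (e f : R * R) :
    'd (coords \o psi) (a, t) ((k *: e + m *: f, 0) : R * R * R) =
    k *: 'd (coords \o psi) (a, t) ((e, 0) : R * R * R)
    + m *: 'd (coords \o psi) (a, t) ((f, 0) : R * R * R).
  rewrite -!linearZ -linearD/=; congr ('d _ _ _).
  by apply/pair_equal_spec; split; rewrite //= !scaler0 addr0.
have sc (r s : R) : r *: s = r * s by [].
move E : xi xi0 de1 de2 => [[x1 y1] [u1 v1]] xi0.
rewrite /coords /= => de1 de2.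
(* The right-hand side is [(k + i m) xi] in real coordinates. *)
have comb (k m : R) : 'd (coords \o psi) (a, t) ((k *: e1 + m *: e2, 0) : R * R * R) =
  (k * x1 - m * y1, k * y1 + m * x1, k * u1 - m * v1, k * v1 + m * u1).
  rewrite lin de1 de2.
  by congr (_, _, _, _); rewrite /= !sc; ring.
have span := @plane_basis _ e1 e2.
have {}span : forall g, exists k m : R, g = k *: e1 + m *: e2.
  apply: span => k m km0.
  have := comb k m; rewrite km0.
  have -> : 'd (coords \o psi) (a, t) ((0, 0) : R * R * R) = 0 by exact: linear0.
  case/pair_equal_spec => /pair_equal_spec[/pair_equal_spec[hx hy] hu] hv.
  have z0 (p q : R) : (0 : R) = p * 0 - q * 0 by rewrite !mulr0 subr0.
  have z1 (p q : R) : (0 : R) = p * 0 + q * 0 by rewrite !mulr0 addr0.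
  have [xy|xy] := boolP ((x1 != 0) || (y1 != 0)).
    exact: (wedge_inj (orP xy) erefl erefl (etrans (esym hx) (z0 0 0)) (etrans (esym hy) (z1 0 0))).
  have uv : (u1 != 0) || (v1 != 0).
    move: xy; rewrite negb_or !negbK => /andP[/eqP x10 /eqP y10].
    apply/negP => /negP; rewrite negb_or !negbK => /andP[/eqP u10 /eqP v10].
    by apply: xi0; rewrite x10 y10 u10 v10.
  exact: (wedge_inj (orP uv) erefl erefl (etrans (esym hu) (z0 0 0)) (etrans (esym hv) (z1 0 0))).
have DE (g : R * R) : exists k m : R,
   [/\ 'D_((g, 0) : R * R * R) (cx \o psi) (a, t) = k * x1 - m * y1,
       'D_((g, 0) : R * R * R) (cy \o psi) (a, t) = k * y1 + m * x1,
       'D_((g, 0) : R * R * R) (cu \o psi) (a, t) = k * u1 - m * v1 &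
       'D_((g, 0) : R * R * R) (cv \o psi) (a, t) = k * v1 + m * u1].
  have [k [m gE]] := span g; exists k, m.
  have := comb k m; rewrite -gE chart_diff//.
  by case/pair_equal_spec => /pair_equal_spec[/pair_equal_spec[-> ->] ->] ->.
move=> g1 g2 /=.
have [k1 [m1 [-> -> -> ->]]] := DE g1; have [k2 [m2 [-> -> -> ->]]] := DE g2.
by clear; split; ring.
Qed.

End ComplexCurve.

(** * Leaves and their closures *)

Section Leaf.
Context {R : realType}.
Implicit Types (S L : set (C2 R)) (A : set (R * R * R -> C2 R)).

Lemma leaf_sub S A L : foliated_atlas S A -> is_leaf S A L -> L `<=` S.
Proof.
move=> [chart _ _] [p0 Sp0 ->] q; rewrite /leaf_through/= => pq; move: Sp0.
elim: pq => {p0 q} [x y [psi [t [Apsi _ [b _ <-]]]]|//|x y z _ IH1 _ IH2].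
  have [_ [Q _ E]] := chart _ Apsi.
  by have : range psi (psi b) by []; rewrite E => -[].
by move=> /IH1.
Qed.

Lemma leaf_plaque S A L psi a a' t : is_leaf S A L -> A psi ->
  L (psi (a, t)) -> L (psi (a', t)).
Proof.
move=> [p0 _ ->] Apsi h; apply: rt_trans h _; apply: rt_step.
by exists psi, t; split=> //; [exists (a, t)|exists (a', t)].
Qed.

(** Chains of plaques can be followed in both directions, so a property that propagates along
    plaques passes between any two points of the leaf. *)
Lemma leaf_ind S A L (P : C2 R -> Prop) : is_leaf S A L ->
  (forall psi a a' t, A psi -> L (psi (a, t)) -> P (psi (a, t)) ->
     P (psi (a', t))) ->
  forall p q, L p -> L q -> P p -> P q.
Proof.
move=> lL step; have [p0 Sp0 LE] := lL.
have Lp0 : L p0 by rewrite LE; exact: rt_refl.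
have both x y : clos_refl_trans _ (same_plaque A) x y -> L x ->
    L y /\ (P x <-> P y).
  elim=> {x y} [x y [psi [t [Apsi [[a s] /= -> <-] [[a' s'] /= -> <-]]]]|//|x y z _ IH1 _ IH2].
    move=> Lx; have Ly := leaf_plaque a' lL Apsi Lx.
    by split=> //; split; exact: step.
  by move=> /IH1[/IH2[Lz h2] h1]; split=> //; rewrite h1.
move=> p q; rewrite LE => /both/(_ Lp0)[_ h1] /both/(_ Lp0)[_ h2].
by rewrite -h1 h2.
Qed.

(** The holomorphic parametrization comes with its own chart [phi]; compatibility of charts places
    it, near the point, in the plaque of [psi]. *)
Lemma leaf_tangent S A L psi a t : foliated_atlas S A -> complex_leaf S A L ->
  A psi -> L (psi (a, t)) -> complex_tangent psi (a, t).
Proof.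
move=> [chart _ compat] [_ imm] Apsi Lp.
have [phi [s [Q [D [gam [[Aphi phip] [oQ Qp] oD dgam [_ gamE]]]]]]] := imm _ Lp.
have [epsi [Q2 oQ2 psiE]] := chart _ Apsi.
have [ephi [Q4 oQ4 phiE]] := chart _ Aphi.
have [z Dz gz] : (gam @` D) (psi (a, t)) by rewrite gamE.
have phir : range phi (psi (a, t)) by case: phip => b _ <-.
have psir : range psi (psi (a, t)) by [].
have [Q3 [oQ3 Q3p comp]] := compat phi psi _ Aphi Apsi phir psir.
have [dg dg0] := dgam z Dz.
apply: (complex_tangent_curve epsi gz dg dg0).
have nD : nbhs z D by exact: open_nbhs_nbhs.
have Q2p : Q2 (psi (a, t)) by move: psir; rewrite psiE => -[].
have cg := complex_derivable_continuous dg.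
have n2 : nbhs z (gam @^-1` Q2).
  by apply: cg; rewrite gz; exact: open_nbhs_nbhs.
have n3 : nbhs z (gam @^-1` Q3).
  by apply: cg; rewrite gz; exact: open_nbhs_nbhs.
near=> k.
have Dk : D k by near: k.
have g2 : Q2 (gam k) by near: k.
have g3 : Q3 (gam k) by near: k.
have [[b bs gb] _] : (plaque phi s `&` Q) (gam k) by rewrite -gamE; exists k.
have Sk : S (gam k).
  have : range phi (gam k) by rewrite -gb.
  by rewrite phiE => -[].
have [[a' t'] _ gE] : range psi (gam k) by rewrite psiE.
exists a'; rewrite -gE; case: phip => b0 b0s b0E.
have gbE : phi b = psi (a', t') by rewrite gb gE.
have -> // : t = t'.
apply: (comp b0 b (a, t) (a', t') _ _ b0E gbE); rewrite ?b0s ?bs//.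
  by rewrite b0E.
by rewrite gb.
Unshelve. all: by end_near. Qed.

End Leaf.

Section Closure.
Context {R : realType}.
Variables (rho : C R * R -> R) (A : set (R * R * R -> C2 R)) (L : set (C2 R)).
Hypothesis rho_smooth : smooth (fun a : R * R * R => rho ((a.1.1 +i* a.1.2)%C, a.2)).
Hypothesis fol : foliated_atlas (graph rho) A.
Hypothesis cleaf : complex_leaf (graph rho) A L.

Let lL : is_leaf (graph rho) A L. Proof. by case: cleaf. Qed.
Let LS : L `<=` graph rho. Proof. exact: leaf_sub lL. Qed.

(** Inside a chart the leaf is a union of full slices, a property which its closure inherits by
    translation along the slices. The tangency relations pass to the limit because they are
    closed. *)
Lemma closure_leaf_plaque psi a a' t : A psi -> closure L (psi (a, t)) ->
  closure L (psi (a', t)) /\ complex_tangent psi (a, t).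
Proof.
move=> Apsi Xp; have [chart _ _] := fol.
have [[spsi imm inj emb] [Q2 oQ2 psiE]] := chart _ Apsi.
have clB : closure (psi @^-1` L) (a, t).
  move=> U nU; have [Q nQ QU] := emb (a, t) U nU.
  have Q2p : Q2 (psi (a, t)).
    by have : range psi (psi (a, t)) by []; rewrite psiE => -[].
  have nQ2 : nbhs (psi (a, t)) Q2 by exact: open_nbhs_nbhs.
  have [q [Lq [Qq Q2q]]] := Xp _ (filterI nQ nQ2).
  have [b _ bq] : range psi q by rewrite psiE; split=> //; exact: LS.
  by exists b; split=> /=; [rewrite bq|apply: QU; rewrite /= bq].
split; last first.
  apply: (closed_complex_tangent spsi); move=> U /clB[[b s] [/= Lb Ub]].
  by exists (b, s); exact: (conj (leaf_tangent fol cleaf Apsi Lb) Ub).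
move=> Q nQ.
have cpsi := chart_continuous spsi.
pose tau (b : R * R * R) : R * R * R := b + (a' - a, 0).
have tauE : tau (a, t) = (a', t).
  by apply/pair_equal_spec; split; rewrite /= ?addr0// addrC subrK.
have nU : nbhs ((a, t) : R * R * R) (tau @^-1` (psi @^-1` Q)).
  have ctau : {for (a, t), continuous tau}.
    by apply: cvgD; [exact: cvg_id|exact: cvg_cst].
  by apply: ctau; rewrite tauE; exact: cpsi.
have [[b s] [/= Lb Qb]] := clB _ nU.
exists (psi (tau (b, s))); split=> //.
have -> : tau (b, s) = (b + (a' - a), s) by rewrite /tau; congr (_, _); rewrite /= addr0.
exact: leaf_plaque lL Apsi Lb.
Qed.

Lemma closure_leaf_graph : closure L `<=` graph rho.
Proof.
suff cS : closed (graph rho) by move=> p Xp; apply: cS => B /Xp[q [/LS]]; exists q.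
pose r3 (a : R * R * R) := rho ((a.1.1 +i* a.1.2)%C, a.2).
have cr : continuous r3.
  by move=> a; apply: differentiable_continuous; have [+ _] := twice_diff_Ck rho_smooth; apply.
have rE p : r3 (cx p, cy p, cu p) = rho (p.1, complex.Re p.2).
  by case: p => -[x y] w.
have -> : graph rho = [set p | cv p - r3 (cx p, cy p, cu p) = 0].
  apply/seteqP; split=> p; rewrite /= rE /graph /cv/=.
    by move=> h; apply/eqP; rewrite subr_eq0; apply/eqP.
  by move/subr0_eq.
have cc : continuous (fun p : C2 R => r3 (cx p, cy p, cu p)).
  apply: (continuous_comp2 _ cr).
  exact: (continuous_pair (continuous_pair continuous_cx continuous_cy) continuous_cu).
apply: (@closed_comp _ _ (fun p => cv p - r3 (cx p, cy p, cu p)) [set 0]);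
  last exact: closed_eq.
by move=> p _; apply: cvgB; [exact: continuous_cv|exact: cc].
Qed.

Lemma closure_leaf_chart p : closure L p ->
  exists psi a t, A psi /\ psi (a, t) = p.
Proof.
move=> /closure_leaf_graph Sp; have [_ cover _] := fol.
by have [psi Apsi [[a t] _ <-]] := cover _ Sp; exists psi, a, t.
Qed.

Lemma closure_leaf_patch psi a t : A psi -> closure L (psi (a, t)) ->
  complex_patch (fun a => cx (psi (a, t))) (fun a => cy (psi (a, t)))
    (fun a => cu (psi (a, t))) (fun a => cv (psi (a, t))).
Proof.
move=> Apsi Xp; have [chart _ _] := fol.
have [epsi [Q2 _ psiE]] := chart _ Apsi.
apply: chart_patch rho_smooth epsi _ _; first by rewrite psiE => q [].
move=> a'; have [Xp' _] := closure_leaf_plaque a' Apsi Xp.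
by have [] := closure_leaf_plaque a' Apsi Xp'.
Qed.

Lemma plaque_open psi a t : A psi -> closure L (psi (a, t)) ->
  \forall b \near (cx (psi (a, t)), cy (psi (a, t))),
    exists a', cx (psi (a', t)) = b.1 /\ cy (psi (a', t)) = b.2.
Proof.
move=> Apsi Xp.
have [d d0 hd] := patch_open (closure_leaf_patch Apsi Xp) (filterT : nbhs a setT).
have h : `|(cx (psi (a, t)), cy (psi (a, t))) - (cx (psi (a, t)), cy (psi (a, t)))| < d.
  by rewrite subrr normr0.
apply: filterS (near_norm_lt h) => -[p q] hpq.
have : (`|p - cx (psi (a, t))| < d) && (`|q - cy (psi (a, t))| < d).
  by rewrite -gt_max.
move=> /andP[hp hq]; have [a' [_ xE yE]] := hd _ _ hp hq.
by exists a'.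
Qed.

Section Extremal.
Variables (a2 b c m : R).
Let phi (p : C2 R) := quad a2 b c (cu p) (cv p).
Hypothesis nondeg : forall p, graph rho p ->
  2 * a2 * cv p + c != 0 \/ b - 2 * a2 * cu p != 0.
Hypothesis le_m : forall p, L p -> phi p <= m.

Lemma closure_le_m p : closure L p -> phi p <= m.
Proof.
have cphi : continuous phi by apply: continuous_quad; [exact: continuous_cu|exact: continuous_cv].
have : closed [set p | phi p <= m].
  apply: (@closed_comp _ _ phi [set t | t <= m]); last exact: closed_le.
  by move=> q _; exact: cphi.
by move=> cm Xp; apply: cm => B /Xp[q [/le_m h Bq]]; exists q.
Qed.

Lemma extremal_plaque psi a a' t : A psi -> closure L (psi (a, t)) ->
  phi (psi (a, t)) = m ->
  cu (psi (a', t)) = cu (psi (a, t)) /\ cv (psi (a', t)) = cv (psi (a, t)).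
Proof.
move=> Apsi Xp pm.
have P := closure_leaf_patch Apsi Xp.
have X' b' : closure L (psi (b', t)) by have [] := closure_leaf_plaque b' Apsi Xp.
have nd b' : 2 * a2 * cv (psi (b', t)) + c != 0 \/ b - 2 * a2 * cu (psi (b', t)) != 0.
  exact: (nondeg (closure_leaf_graph (X' b'))).
have lem b' : quad a2 b c (cu (psi (b', t))) (cv (psi (b', t))) <= m.
  exact: (closure_le_m (X' b')).
exact: (patch_max_const P nd lem pm).
Qed.

(** The z for which the point belongs to the closure form a closed set. It is also open: w is
    constant on an extremal plaque, and z is open on it. *)
Lemma extremal_line q : closure L q -> phi q = m ->
  forall z : R * R, closure L (of_coords (z, cu q, cv q)).
Proof.
move=> Xq qm; pose ell (z : R * R) := of_coords (z, cu q, cv q).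
have cell : continuous ell.
  apply: (continuous_comp2 _ continuous_of_coords).
  have ci : continuous (fun z : R * R => z) by move=> z; exact: cvg_id.
  have cc (k : R) : continuous (fun _ : R * R => k) by move=> z; exact: cvg_cst.
  exact: (continuous_pair (continuous_pair ci (cc _)) (cc _)).
apply: (@clopen_all _ _ (fun z => closure L (ell z))).
- exists (cx q, cy q); rewrite /ell.
  by have -> : of_coords (cx q, cy q, cu q, cv q) = q by exact: coordsK.
- by apply: (@closed_comp _ _ ell (closure L)); [move=> z _; exact: cell|exact: closed_closure].
- move=> z Xz; have [psi [a [t [Apsi pE]]]] := closure_leaf_chart Xz.
  have Xp : closure L (psi (a, t)) by rewrite pE.
  have pm : phi (psi (a, t)) = m by rewrite pE -qm.
  have := plaque_open Apsi Xp.
  have -> : (cx (psi (a, t)), cy (psi (a, t))) = z by rewrite pE; case: (z).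
  apply: filterS => z' [a' [xE yE]].
  have [uE vE] := extremal_plaque a' Apsi Xp pm.
  have -> : ell z' = psi (a', t).
    by rewrite -[RHS]coordsK /ell [z']surjective_pairing -xE -yE /coords -!/(cu _) -!/(cv _) uE vE pE.
  by have [] := closure_leaf_plaque a' Apsi Xp.
Qed.

(** The plaques through points of the line are open pieces of it, and each is either contained in
    [L] or disjoint from it. The line is connected, so it lies in [L]; propagation along plaques
    gives the converse. *)
Lemma extremal_leaf q : closure L q -> phi q = m ->
  forall p, L p -> cu p = cu q -> cv p = cv q ->
  L = [set p' | cu p' = cu q /\ cv p' = cv q].
Proof.
move=> Xq qm p Lp pu pv.
have Xell := extremal_line Xq qm.
pose ell (z : R * R) := of_coords (z, cu q, cv q).
have ellE p' : cu p' = cu q -> cv p' = cv q -> ell (cx p', cy p') = p'.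
  by rewrite /ell => <- <-; exact: coordsK.
have pmE p' : cu p' = cu q -> cv p' = cv q -> phi p' = m.
  by rewrite /phi => -> ->; exact: qm.
have Lell p' : L p' -> cu p' = cu q /\ cv p' = cv q.
  move=> Lp'.
  apply: (leaf_ind (P := fun p' => cu p' = cu q /\ cv p' = cv q) lL _ Lp Lp' (conj pu pv)).
  move=> psi a a' t Apsi La [ua va].
  have [-> ->] := extremal_plaque a' Apsi (subset_closure La) (pmE _ ua va).
  by split.
have near_ell psi a t z : A psi -> psi (a, t) = ell z ->
    \forall z' \near z, exists a', psi (a', t) = ell z'.
  move=> Apsi pE.
  have Xp : closure L (psi (a, t)) by rewrite pE; exact: Xell.
  have pm : phi (psi (a, t)) = m by rewrite pE; exact: qm.
  have := plaque_open Apsi Xp.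
  have -> : (cx (psi (a, t)), cy (psi (a, t))) = z by rewrite pE; case: (z).
  apply: filterS => z' [a' [xE yE]]; exists a'.
  have [uE vE] := extremal_plaque a' Apsi Xp pm.
  rewrite [z']surjective_pairing -xE -yE; apply/esym/ellE.
    by rewrite uE pE.
  by rewrite vE pE.
have all z : L (ell z).
  apply: (@clopen_all _ _ (fun z => L (ell z))).
  - by exists (cx p, cy p); rewrite ellE.
  (* A point of the line outside [L] has a plaque which avoids [L] and covers a neighbourhood in the
     line. *)
  - rewrite -(setCK (fun z => L (ell z))); apply: open_closedC.
    rewrite openE => z' nLz'.
    have [psi [a [t [Apsi pE]]]] := closure_leaf_chart (Xell z').
    apply: filterS (near_ell psi a t z' Apsi pE) => z'' [a' pE'] Lz''.
    apply: nLz'; rewrite -[ell z']pE; apply: (leaf_plaque a lL Apsi (a := a')).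
    by rewrite pE'.
  - move=> z' Lz'.
    have [psi [a [t [Apsi pE]]]] := closure_leaf_chart (Xell z').
    apply: filterS (near_ell psi a t z' Apsi pE) => z'' [a' <-].
    by apply: (leaf_plaque a' lL Apsi (a := a)); rewrite pE.
apply/seteqP; split=> [p' /Lell//|p' [pu' pv']].
by rewrite -(ellE _ pu' pv'); exact: all.
Qed.

End Extremal.
End Closure.

(** * Liouville argument *)

(** The box of parameters has measure 1, so a null set cannot contain it. *)
Lemma ae_lebesgue5_ex {R : realType} (P : R * R * R * R * R -> Prop) (N : R) :
  {ae @lebesgue5 R, forall b, P b} ->
  exists b, [/\ P b, 0 < b.1.1.1.1 < 1 /\ 0 < b.1.1.1.2 < 1,
    0 < b.1.1.2 < 1 /\ 0 < b.1.2 < 1 & N < b.2 < N + 1].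
Proof.
move=> [Z [mZ Z0 PZ]].
apply: contrapT => none.
pose I : set (measurableTypeR R) := [set` `]0%R, 1%R[].
pose J : set (measurableTypeR R) := [set` `]N, (N + 1)[].
have mI : measurable I by exact: measurable_itv.
have mJ : measurable J by exact: measurable_itv.
have m4 := measurableX (measurableX (measurableX mI mI) mI) mI.
have m5 := measurableX m4 mJ.
have sub : I `*` I `*` I `*` I `*` J `<=` Z.
  move=> b; rewrite /I /J /= !in_itv/= => bI; apply: PZ => Pb.
  by apply: none; exists b; split=> //; case: bI => -[[[? ?] ?] ?] ?.
have : (lebesgue5 (I `*` I `*` I `*` I `*` J) <= 0)%E.
  by rewrite -Z0; apply: le_measure => //; rewrite inE.
have lI : lebesgue_measure I = 1%E.
  by rewrite lebesgue_measure_itv/= lte_fin ltr01 oppr0 adde0.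
have lJ : lebesgue_measure J = 1%E.
  rewrite lebesgue_measure_itv/= lte_fin ltrDl ltr01.
  by rewrite -EFinB addrAC subrr add0r.
have m2 := measurableX mI mI; have m3 := measurableX m2 mI.
have e2 : (@lebesgue_measure R \x @lebesgue_measure R)%E (I `*` I) = 1%E.
  by rewrite product_measure1E// -[1%E]mule1; congr (_ * _)%E; exact: lI.
have e3 : ((@lebesgue_measure R \x @lebesgue_measure R) \x @lebesgue_measure R)%E
    (I `*` I `*` I) = 1%E.
  by rewrite product_measure1E// -[1%E]mule1; congr (_ * _)%E; [exact: e2|exact: lI].
have e4 : (((@lebesgue_measure R \x @lebesgue_measure R) \x @lebesgue_measure R)
    \x @lebesgue_measure R)%E (I `*` I `*` I `*` I) = 1%E.
  by rewrite product_measure1E// -[1%E]mule1; congr (_ * _)%E; [exact: e3|exact: lI].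
have -> : lebesgue5 (I `*` I `*` I `*` I `*` J) = 1%E.
  rewrite /lebesgue5 product_measure1E// -[1%E]mule1.
  by congr (_ * _)%E; [exact: e4|exact: lJ].
by rewrite lee_fin ler10.
Qed.

(** As only almost every ball is available, the centre is taken somewhere in the unit cube. A point
    with coordinates bounded by [N] differs from it by at most [N + 1] in each of the four
    coordinates, so a radius above [2 * (N + 1)] puts the point in the interior. *)
Lemma good_ball {R : realType} (S L : set (C2 R)) (N : R) : 0 <= N ->
  properly_embedded S L -> exists (B : set (C2 R)) (W : R), [/\ closed B,
    forall p, `|cx p| <= N -> `|cy p| <= N -> `|cu p| <= N -> `|cv p| <= N ->
      nbhs p B,
    forall p, (B `&` L) p -> compact (connected_component (B `&` L) p) &
    forall p, B p -> `|cx p| <= W /\ `|cy p| <= W].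
Proof.
move=> N0 /(@ae_lebesgue5_ex _ _ (2 * (N + 1))).
case=> -[[[[b1 b2] b3] b4] r] /= [Pb [hb1 hb2] [hb3 hb4] /andP[hr _]].
have r0 : 0 < r by rewrite (lt_trans _ hr)// mulr_gt0// ltr_wpDl.
set k := of_coords (b1, b2, b3, b4) in Pb.
pose f (p : C2 R) := (cx p - b1) ^+ 2 + (cy p - b2) ^+ 2 + (cu p - b3) ^+ 2 + (cv p - b4) ^+ 2.
have fE p : closed_eball k r p = (f p <= r ^+ 2).
  by case: p => -[x y] [u v].
have cf : continuous f.
  have cs (g : C2 R -> R) (t : R) : continuous g -> continuous (fun p => (g p - t) ^+ 2).
    move=> cg; apply: (continuous_comp2 (f := fun p => g p - t) (g := fun s : R => s ^+ 2)).
      by move=> p; apply: cvgB; [exact: cg|exact: cvg_cst].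
    exact: exprn_continuous.
  have [c1 c2] := (cs _ b1 continuous_cx, cs _ b2 continuous_cy).
  have [c3 c4] := (cs _ b3 continuous_cu, cs _ b4 continuous_cv).
  by move=> p; apply: cvgD; [apply: cvgD; [apply: cvgD; [exact: c1|exact: c2]|exact: c3]|exact: c4].
exists (closed_eball k r), (r + 1); split.
- have -> : closed_eball k r = [set p | f p <= r ^+ 2].
    by apply/funext => p; rewrite fE.
  apply: (@closed_comp _ _ f [set t | t <= r ^+ 2]); last exact: closed_le.
  by move=> p _; exact: cf.
- move=> p hx hy hu hv.
  have sq (t b : R) : `|t| <= N -> 0 < b < 1 -> (t - b) ^+ 2 <= (N + 1) ^+ 2.
    move=> tN /andP[b0 b1']; rewrite -(real_normK (num_real (t - b))).
    rewrite ler_pXn2r ?nnegrE ?addr_ge0// (le_trans (ler_normB _ _))// lerD//.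
    by rewrite gtr0_norm// ltW.
  have fr : f p < r ^+ 2.
    apply: (@le_lt_trans _ _ ((2 * (N + 1)) ^+ 2)).
      have -> : (2 * (N + 1)) ^+ 2 = (N + 1) ^+ 2 + (N + 1) ^+ 2 + (N + 1) ^+ 2 + (N + 1) ^+ 2.
        by ring.
      by rewrite /f !lerD// sq.
    by rewrite ltr_pXn2r// nnegrE ?(ltW r0)// mulr_ge0// addr_ge0.
  have nf : \forall p' \near p, f p' < r ^+ 2 by exact: (cvgr_lt (f p) (cf p)).
  by apply: filterS nf => p' /ltW; rewrite fE.
- by move=> p BLp; have [] := Pb r0 p BLp.
- move=> p; rewrite fE => fp.
  have sq (t b e : R) : 0 < b < 1 -> 0 <= e -> (t - b) ^+ 2 + e <= r ^+ 2 -> `|t| <= r + 1.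
    move=> /andP[b0 b1'] e0 h; rewrite -(subrK b t) (le_trans (ler_normD _ _))// lerD//.
      rewrite -(@ler_pXn2r _ 2)// ?nnegrE ?(ltW r0)// real_normK ?num_real//.
      by rewrite (le_trans _ h)// lerDl.
    by rewrite gtr0_norm// ltW.
  split.
    apply: (sq _ _ ((cy p - b2) ^+ 2 + (cu p - b3) ^+ 2 + (cv p - b4) ^+ 2) hb1).
      by rewrite !addr_ge0 ?sqr_ge0.
    by rewrite !addrA.
  apply: (sq _ _ ((cx p - b1) ^+ 2 + (cu p - b3) ^+ 2 + (cv p - b4) ^+ 2) hb2).
    by rewrite !addr_ge0 ?sqr_ge0.
  by rewrite !addrA [X in X + _ + _ <= _]addrC.
Qed.

Lemma is_derive_log_barrier {R : realType} (e s d q : R) : 0 < q ->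
  is_derive q (1 : R) (fun t => e * (ln t - ln s) - d * t) (e * q^-1 - d).
Proof.
move=> q0.
have d1 := is_deriveB (is_derive1_ln q0) (is_derive_cst (ln s) q (1 : R)).
have d2 := is_deriveZ e d1; have d3 := is_deriveZ d (is_derive_id q (1 : R)).
apply: is_derive_eq (is_deriveB d2 d3) _.
have sc (k t : R) : k *: t = k * t by [].
by rewrite !sc subr0 mulr1.
Qed.

Lemma is_derive_log_barrier2 {R : realType} (e d q : R) : 0 < q ->
  is_derive q (1 : R) (fun t => e * t^-1 - d) (- e * q ^- 2).
Proof.
move=> q0; have d1 := is_derive_inv e (lt0r_neq0 q0).
have := is_deriveB d1 (is_derive_cst d q (1 : R)).
by rewrite subr0.
Qed.

(** This statement and the next two exclude the ways in which the maximum in [leaf_liouville] could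
    fail to be interior: on the inner boundary [q = s], at large |z|, at large |u|. *)
Lemma near_center_absurd {R : realType} (a b t eps : R) :
  t <= eps / 4 -> 0 < eps -> b - eps / 2 <= a + t -> a < b - eps -> False.
Proof. by lra. Qed.

Lemma far_z_absurd {R : realType} (T a x y m : R) :
  T <= a - (x - y) -> y <= 1 -> a <= m -> m + 2 - T <= x -> False.
Proof. by lra. Qed.

Lemma far_u_absurd {R : realType} (T a x y : R) :
  T <= a - (x - y) -> y <= 1 -> a < T - 1 -> 0 <= x -> False.
Proof. by lra. Qed.

Lemma ler_sqr_succ {R : realType} (Q : R) : 0 < Q -> Q <= (Q + 1) ^+ 2.
Proof. by nra. Qed.

Section Liouville.
Context {R : realType}.
Variables (rho : C R * R -> R) (A : set (R * R * R -> C2 R)) (L : set (C2 R)).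
Hypothesis rho_smooth : smooth (fun a : R * R * R => rho ((a.1.1 +i* a.1.2)%C, a.2)).
Hypothesis fol : foliated_atlas (graph rho) A.
Hypothesis cleaf : complex_leaf (graph rho) A L.
Hypothesis prop_emb : properly_embedded (graph rho) L.

Let lL : is_leaf (graph rho) A L. Proof. by case: cleaf. Qed.

(** Images of short segments of the slice join the points inside [B] and [L]. Hence a maximum over
    the component, at a point interior to [B], is a local maximum on the plaque. *)
Lemma component_plaque (B : set (C2 R)) psi a t p : A psi -> L (psi (a, t)) ->
  connected_component (B `&` L) p (psi (a, t)) -> nbhs (psi (a, t)) B ->
  \forall a' \near a, connected_component (B `&` L) p (psi (a', t)).
Proof.
move=> Apsi La Ka nB.
have [chart _ _] := fol; have [[spsi _ _ _] _] := chart _ Apsi.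
have cpsi := chart_continuous spsi.
have csl : continuous (fun a' => psi (a', t)).
  apply: (continuous_comp2 _ cpsi); apply: continuous_pair => [a'|a'].
    exact: cvg_id.
  exact: cvg_cst.
have /nbhs_normP[d /= d0 hd] : nbhs a (fun a' => B (psi (a', t))) by exact: csl.
apply/nbhs_normP; exists d => //= a' a'd.
rewrite (same_connected_component Ka).
pose seg := (fun s : R => psi (a + s *: (a' - a), t)).
have cseg : continuous seg.
  apply: (continuous_comp2 _ csl) => s.
  by apply: cvgD; [exact: cvg_cst|apply: cvgZ; [exact: cvg_id|exact: cvg_cst]].
have seg0 : seg 0 = psi (a, t) by rewrite /seg scale0r addr0.
have seg1 : seg 1 = psi (a', t) by rewrite /seg scale1r addrC subrK.
apply: (@connected_component_max _ _ (seg @` `[0, 1])).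
- by exists 0 => //=; rewrite in_itv/= lexx ler01.
- move=> _ [s /= s01 <-]; move: s01; rewrite in_itv/= => /andP[s0 s1].
  split; last exact: leaf_plaque lL Apsi La.
  apply: hd; rewrite /= opprD addrA subrr add0r normrN normrZ ger0_norm//.
  by rewrite (le_lt_trans _ a'd)// distrC ler_piMl.
- apply: connected_continuous_connected; first exact: segment_connected.
  exact: continuous_subspaceT.
- by exists 1 => //=; rewrite in_itv/= lexx ler01.
Qed.

Variables (a2 b c M M1 : R).
Let phi (p : C2 R) := quad a2 b c (cu p) (cv p).
Hypothesis cvM : forall p, L p -> `|cv p| <= M.
Hypothesis le_M1 : forall p, L p -> phi p <= M1.
Hypothesis phi_infty : forall N, exists k, forall p, L p -> k < `|cu p| -> phi p < N.

(* Otherwise, phi - e ln (q / s) + d q with q = |z - z0|^2 would have an interior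
   maximum on the part {q >= s} of a compact piece of L; the term d q makes the
   barrier strict, d being chosen after the ball. *)
Lemma leaf_liouville (x0 y0 s eps : R) p0 : L p0 -> 0 < s -> 0 < eps ->
  exists p, [/\ L p, dist2 x0 y0 (cx p) (cy p) <= s & phi p0 - eps <= phi p].
Proof.
move=> Lp0 s0 eps0; apply: contrapT => none.
pose q p := dist2 x0 y0 (cx p) (cy p).
have far p : L p -> q p <= s -> phi p < phi p0 - eps.
  by move=> Lp qp; rewrite ltNge; apply/negP => h; apply: none; exists p.
have q0s : s < q p0.
  rewrite ltNge; apply/negP => /(far _ Lp0).
  by rewrite ltrBrDl gtrDr ltNge ltW.
have q00 := lt_trans s0 q0s.
have l0 : 0 < ln (q p0) - ln s by rewrite subr_gt0 ltr_ln.
(* The logarithmic term then costs exactly [eps / 2] at [p0], so the perturbed function is at least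
   [T] there. *)
set e := eps / (2 * (ln (q p0) - ln s)).
have e0 : 0 < e by rewrite divr_gt0// mulr_gt0.
pose T := phi p0 - eps / 2.
(* Beyond [Q1] the logarithmic term exceeds [M1 + 2 - T]. Even after the linear term gives back 1,
   the perturbed function is below [T]. This threshold is independent of the ball and of [d]. *)
pose Q1 := expR (ln s + (M1 + 2 - T) / e).
have Q10 : 0 < Q1 by exact: expR_gt0.
have lnQ1 : ln Q1 = ln s + (M1 + 2 - T) / e by exact: expRK.
clearbody Q1.
have [k hk] := phi_infty (T - 1).
(* The ball must contain in its interior [p0] and every point with [q <= Q1], |u| at most [k] and
   |v| at most [M], where the maximum will be found; [Q1 + 1] bounds the square root of [Q1]. *)
pose N := `|cx p0| + `|cy p0| + `|cu p0| + `|cv p0| + `|x0| + `|y0| + (Q1 + 1) + `|k| + `|M|.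
have Nbig (t : R) : t <= `|cx p0| \/ t <= `|cy p0| \/ t <= `|cu p0| \/ t <= `|cv p0| \/
    t <= `|x0| + (Q1 + 1) \/ t <= `|y0| + (Q1 + 1) \/ t <= `|k| \/ t <= `|M| -> t <= N.
  rewrite /N.
  have := normr_ge0 (cx p0); have := normr_ge0 (cy p0).
  have := normr_ge0 (cu p0); have := normr_ge0 (cv p0).
  have := normr_ge0 x0; have := normr_ge0 y0; have := normr_ge0 k; have := normr_ge0 M.
  move: Q10; clear.
  move: `|cx p0| `|cy p0| `|cu p0| `|cv p0| `|x0| `|y0| `|k| `|M| => *.
  by repeat (match goal with H : _ \/ _ |- _ => destruct H end); lra.
have N0 : 0 <= N by apply: Nbig; left.
have [B [W [cB inB compB BW]]] := good_ball N0 prop_emb.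
have p0B : B p0.
  apply: nbhs_singleton; apply: inB; apply: Nbig.
  - by left.
  - by right; left.
  - by do 2 right; left.
  - by do 3 right; left.
have [W0 _] := BW _ p0B.
have {}W0 : 0 <= W by exact: le_trans (normr_ge0 _) W0.
pose WQ := (W + `|x0|) ^+ 2 + (W + `|y0|) ^+ 2.
have qWQ p : B p -> q p <= WQ.
  move=> /BW[hx hy]; rewrite /q /dist2 /WQ.
  have sq (t w u : R) : `|t| <= w -> (t - u) ^+ 2 <= (w + `|u|) ^+ 2.
    move=> tw; rewrite -(real_normK (num_real (t - u))) ler_pXn2r//.
      by rewrite (le_trans (ler_normB _ _))// lerD2r.
    by rewrite nnegrE addr_ge0// (le_trans _ tw).
  by rewrite lerD// sq.
have WQ0 : 0 <= WQ by rewrite addr_ge0// sqr_ge0.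
(* The first entry keeps the linear term below 1 on the ball. The second keeps it below [eps / 4]
   where [q = s]: there [phi] is more than [eps] below [phi p0], whereas [T] is only [eps / 2]
   below. *)
pose d := Num.min (WQ + 1)^-1 (eps / (4 * s)).
have d0 : 0 < d by rewrite lt_min invr_gt0 ltr_wpDl//= divr_gt0// mulr_gt0.
have dB p : B p -> d * q p <= 1.
  move=> Bp; apply: (@le_trans _ _ ((WQ + 1)^-1 * (WQ + 1))).
    apply: ler_pM; rewrite ?(ltW d0)//; first by rewrite addr_ge0// sqr_ge0.
      by rewrite ge_min lexx.
    by rewrite (le_trans (qWQ _ Bp))// lerDl.
  by rewrite mulVf// gt_eqF// ltr_wpDl.
have ds : d * s <= eps / 4.
  apply: (@le_trans _ _ (eps / (4 * s) * s)).
    by rewrite ler_pM2r// ge_min lexx orbT.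
  by rewrite [leLHS](_ : _ = eps / 4)//; field; rewrite gt_eqF.
pose g t := e * (ln t - ln s) - d * t.
pose Phi p := phi p - g (q p).
pose K := connected_component (B `&` L) p0.
have cK : compact K by exact: compB.
have KBL p : K p -> B p /\ L p by move/connected_component_sub.
have cphi : continuous phi by apply: continuous_quad; [exact: continuous_cu|exact: continuous_cv].
have cq : continuous q by apply: continuous_dist2; [exact: continuous_cx|exact: continuous_cy].
have Kp0 : K p0 by exact: connected_component_refl.
have [|||p1] := @compact_EVT_max _ _ Phi (K `&` [set p | s <= q p]).
- by exists p0; split=> //=; rewrite ltW.
- apply: compact_closedI => //; apply: (@closed_comp _ _ q [set t | s <= t]).
    by move=> p _; exact: cq.
  exact: closed_ge.
- apply: continuous_in_subspaceT => p; rewrite inE => -[_ /= sq].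
  have q0 := lt_le_trans s0 sq.
  have cln : {for q p, continuous g}.
    apply/differentiable_continuous/derivable1_diffP.
    by have [] := is_derive_log_barrier e s d q0.
  by apply: cvgB; [exact: cphi|exact: (continuous_comp (cq p) cln)].
rewrite inE => -[Kp1 /= sq1] p1max.
have [Bp1 Lp1] := KBL _ Kp1.
have PT : T <= Phi p1.
  apply: (@le_trans _ _ (Phi p0)); last by apply: p1max; rewrite inE; split=> //=; rewrite ltW.
  rewrite /Phi /g /T opprB addrA.
  have -> : e * (ln (q p0) - ln s) = eps / 2 by rewrite /e; field; rewrite gt_eqF.
  by rewrite lerD2r lerDl mulr_ge0// ltW.
have q10 := lt_le_trans s0 sq1.
have sq1' : s < q p1.
  rewrite lt_neqAle sq1 andbT; apply/eqP => sE.
  have := far _ Lp1; rewrite -sE lexx => /(_ isT).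
  move: PT; rewrite /Phi /g -sE subrr mulr0 sub0r opprK /T; move: ds eps0.
  exact: near_center_absurd.
have lnge : ln s <= ln (q p1) by rewrite ler_ln.
have qQ1 : q p1 <= Q1.
  rewrite leNgt; apply/negP => Q1q.
  have lnQ : ln Q1 <= ln (q p1) by rewrite ler_ln// ltW.
  have h1 : M1 + 2 - T <= e * (ln (q p1) - ln s).
    rewrite -ler_pdivrMl// lerBrDl mulrC -lnQ1//.
  move: PT (dB _ Bp1) (le_M1 Lp1) h1; rewrite /Phi /g.
  exact: far_z_absurd.
have uk : `|cu p1| <= k.
  rewrite leNgt; apply/negP => ku.
  have h1 : 0 <= e * (ln (q p1) - ln s) by rewrite mulr_ge0 ?(ltW e0)// subr_ge0.
  move: PT (dB _ Bp1) (hk _ Lp1 ku) h1; rewrite /Phi /g.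
  exact: far_u_absurd.
have sqQ (t u : R) : (t - u) ^+ 2 <= Q1 -> `|t| <= `|u| + (Q1 + 1).
  move=> h; rewrite addrC -(subrK u t) (le_trans (ler_normD _ _))// lerD//.
  have Q1p : 0 <= Q1 + 1 by rewrite addr_ge0// ltW.
  rewrite -(@ler_pXn2r _ 2)// ?nnegrE// real_normK ?num_real// (le_trans h)//.
  exact: ler_sqr_succ.
have nB : nbhs p1 B.
  apply: inB; apply: Nbig.
  - do 4 right; left; apply: sqQ; apply: le_trans qQ1.
    by rewrite /q /dist2 lerDl sqr_ge0.
  - do 5 right; left; apply: sqQ; apply: le_trans qQ1.
    by rewrite /q /dist2 lerDr sqr_ge0.
  - by do 6 right; left; exact: le_trans uk (ler_norm _).
  - by do 7 right; exact: le_trans (cvM Lp1) (ler_norm _).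
have Xp1 : closure L p1 by exact: subset_closure.
have [psi [a [t [Apsi pE]]]] := closure_leaf_chart rho_smooth fol cleaf Xp1.
rewrite -{}pE in Xp1 Kp1 nB Lp1 sq1' p1max q10 {PT sq1 Bp1 lnge qQ1 uk}.
have P := closure_leaf_patch rho_smooth fol cleaf Apsi Xp1.
have nK := component_plaque Apsi Lp1 Kp1 nB.
have [tx _ _ _] := P.
have csl (f : R * R -> R) : twice_diff f -> continuous f by exact: twice_diff_continuous.
have cqs : continuous (fun a' => q (psi (a', t))).
  by apply: continuous_dist2; apply: csl; [exact: tx.1|exact: tx.2].
have nq : \forall a' \near a, s < q (psi (a', t)) by exact: (cvgr_gt _ (cqs a)).
have dg : \forall r \near q (psi (a, t)), is_derive r (1 : R) g (e * r^-1 - d).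
  by apply: filterS (lt_nbhsr q10) => r r0; exact: is_derive_log_barrier.
apply: (patch_no_max P dg (is_derive_log_barrier2 e d q10)).
  rewrite -/(q _); set r := q (psi (a, t)) in q10 *.
  (* The logarithm is harmonic, so only the linear term contributes to the Laplacian. *)
  have -> : r * (- e * r ^- 2) + (e * r^-1 - d) = - d by field; rewrite gt_eqF.
  by rewrite oppr_lt0.
by apply: filterS2 nK nq => a' Ka' /ltW qa'; apply: p1max; rewrite inE.
Qed.

End Liouville.

(** * Horizontal lines in the closure of a leaf *)

Lemma compact_of_bounded {R : realType} (B : set (C2 R)) (N : R) : closed B ->
  (forall p, B p -> [/\ `|cx p| <= N, `|cy p| <= N, `|cu p| <= N & `|cv p| <= N]) ->
  compact B.
Proof.
move=> cB hB.
have cs : compact (`[(- N), N] : set R) by exact: segment_compact.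
have cbox := compact_setX (compact_setX (compact_setX cs cs) cs) cs.
have cim : compact (of_coords @` (`[(- N), N] `*` `[(- N), N] `*` `[(- N), N] `*` `[(- N), N])).
  apply: continuous_compact cbox.
  by apply: continuous_subspaceT; exact: continuous_of_coords.
apply: subclosed_compact cB cim _ => p /hB[hx hy hu hv].
exists (coords p); last exact: coordsK.
by rewrite /= !in_itv/= -!ler_norml.
Qed.

Lemma sup_half_split {R : realType} (m e x : R) : m - e / 2 < x -> m - e <= x - e / 2.
Proof. by lra. Qed.

Section Walls.
Context {R : realType}.
Variables (rho : C R * R -> R) (A : set (R * R * R -> C2 R)) (L : set (C2 R)).
Hypothesis rho_smooth : smooth (fun a : R * R * R => rho ((a.1.1 +i* a.1.2)%C, a.2)).
Hypothesis fol : foliated_atlas (graph rho) A.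
Hypothesis cleaf : complex_leaf (graph rho) A L.
Hypothesis prop_emb : properly_embedded (graph rho) L.
Variable M : R.
Hypothesis rhoM : forall q, `|rho q| <= M.

Let lL : is_leaf (graph rho) A L. Proof. by case: cleaf. Qed.
Let LS : L `<=` graph rho. Proof. exact: leaf_sub lL. Qed.

Let cvM p : graph rho p -> `|cv p| <= M.
Proof. by rewrite /graph /= /cv => ->; exact: rhoM. Qed.

Let Lne : L !=set0.
Proof. by case: lL => p0 _ ->; exists p0; exact: rt_refl. Qed.

(** Values near the supremum [m] are found over the unit disc of the z-plane. The points of [L]
    there with [phi >= m - 1] are bounded, [u] by the decay of [phi] and [v] by [M], so their
    closure is compact. *)
Lemma extremal_exists (a2 b c : R) :
  let phi p := quad a2 b c (cu p) (cv p) in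
  (forall N, exists k, forall p, L p -> k < `|cu p| -> phi p < N) ->
  (exists m, forall p, L p -> phi p <= m) ->
  exists q, closure L q /\ forall p, L p -> phi p <= phi q.
Proof.
move=> phi inf [m1 hm1].
have cphi : continuous phi by apply: continuous_quad; [exact: continuous_cu|exact: continuous_cv].
have hs : has_sup (phi @` L).
  by split; [exact: image_nonempty|exists m1 => _ [p Lp <-]; exact: hm1].
pose m := sup (phi @` L).
have le_m p : L p -> phi p <= m.
  by move=> Lp; apply: sup_upper_bound => //; exists p.
have [k hk] := inf (m - 1).
pose F := [set p : C2 R | dist2 0 0 (cx p) (cy p) <= 1] `&` [set p : C2 R | m - 1 <= phi p].
have approx eps : 0 < eps -> eps <= 1 -> exists p, [/\ L p, F p & m - eps <= phi p].
  move=> e0 e1; have e2 : 0 < eps / 2 by rewrite divr_gt0.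
  have [_ [p0 Lp0 <-] hp0] := sup_adherent e2 hs.
  have cvL p : L p -> `|cv p| <= M by move/LS/cvM.
  have [p [Lp dp hp]] := leaf_liouville rho_smooth fol cleaf prop_emb cvL le_m inf
    0 0 Lp0 ltr01 e2.
  have hp' : m - eps <= phi p.
    by apply: le_trans hp; exact: sup_half_split hp0.
  exists p; split=> //; split=> //=.
  by apply: le_trans hp'; rewrite lerD2l lerN2.
pose N := 1 + `|k| + M.
have M0 : 0 <= M by apply: le_trans (rhoM (0, 0)).
have Fclosed : closed F.
  apply: closedI.
    apply: (@closed_comp _ _ (fun p => dist2 0 0 (cx p) (cy p)) [set t | t <= 1]);
      last exact: closed_le.
    by move=> p _; apply: continuous_dist2; [exact: continuous_cx|exact: continuous_cy].
  apply: (@closed_comp _ _ phi [set t | m - 1 <= t]); last exact: closed_ge.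
  by move=> p _; exact: cphi.
have cXF : compact (closure (L `&` F)).
  have FN : L `&` F `<=` [set p | [/\ `|cx p| <= N, `|cy p| <= N, `|cu p| <= N & `|cv p| <= N]].
    move=> p [Lp [/= dp hp]].
    have sq1 (t u : R) : t ^+ 2 + u ^+ 2 <= 1 -> `|t| <= 1.
      move=> h; rewrite -(@ler_pXn2r _ 2)// ?nnegrE// expr1n real_normK ?num_real//.
      by rewrite (le_trans _ h)// lerDl sqr_ge0.
    move: dp; rewrite /dist2 !subr0 => dp.
    have N1 : 1 <= N by rewrite /N -addrA lerDl addr_ge0.
    split.
    - exact: le_trans (sq1 _ _ dp) N1.
    - by apply: le_trans N1; rewrite addrC in dp; exact: sq1 dp.
    - have : `|cu p| <= k.
        by rewrite leNgt; apply/negP => /(hk _ Lp); rewrite ltNge hp.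
      move=> /le_trans; apply; apply: le_trans (ler_norm _) _.
      by rewrite /N addrAC lerDr addr_ge0// ler01.
    - by apply: le_trans (cvM (LS Lp)) _; rewrite /N lerDr addr_ge0// ler01.
  apply: (@compact_of_bounded _ _ N); first exact: closed_closure.
  have cN : closed [set p : C2 R | [/\ `|cx p| <= N, `|cy p| <= N, `|cu p| <= N & `|cv p| <= N]].
    have cl (f : C2 R -> R) : continuous f -> closed [set p | `|f p| <= N].
      move=> cf; apply: (@closed_comp _ _ (fun p => `|f p|) [set t | t <= N]);
        last exact: closed_le.
      by move=> p _; apply: continuous_comp; [exact: cf|exact: norm_continuous].
    have -> : [set p : C2 R | [/\ `|cx p| <= N, `|cy p| <= N, `|cu p| <= N & `|cv p| <= N]] =
      ([set p | `|cx p| <= N] `&` [set p | `|cy p| <= N]) `&`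
      ([set p | `|cu p| <= N] `&` [set p | `|cv p| <= N]).
      by apply/seteqP; split=> p /=; [case=> ? ? ? ?; split; split|case=> -[? ?] [? ?]; split].
    by apply: closedI; apply: closedI; apply: cl; [exact: continuous_cx|exact: continuous_cy
      |exact: continuous_cu|exact: continuous_cv].
  by move=> p clp; apply: cN => B /clp[q [/FN h Bq]]; exists q.
have [||q] := @compact_EVT_max _ _ phi _ _ cXF.
- have [p [Lp Fp _]] := approx 1 ltr01 (lexx 1).
  by exists p; apply: subset_closure; split.
- exact: continuous_subspaceT.
move=> /set_mem clq qmax; exists q; split.
  by move=> B /clq[p [[Lp _] Bp]]; exists p.
have mq : m <= phi q.
  apply/ler_addgt0Pr => eps eps0.
  pose e := Num.min eps 1.
  have e0 : 0 < e by rewrite lt_min eps0 ltr01.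
  have [e1 e2] : e <= 1 /\ e <= eps by rewrite !ge_min !lexx orbT.
  have [p [Lp Fp hp]] := approx e e0 e1.
  have h := qmax p (mem_set (subset_closure (conj Lp Fp))).
  rewrite -lerBlDr (le_trans _ h)// (le_trans _ hp)// lerD2l lerN2//.
by move=> p /le_m h; exact: le_trans h mq.
Qed.

(** The sign [s] treats the two sides uniformly. The inequality is strict along [L] only: on the
    closure, which contains the line itself, it becomes weak. *)
Definition wall (q : C2 R) (s : R) : Prop :=
  [/\ closure L q, forall z : R * R, closure L (of_coords (z, cu q, cv q)),
      s = 1 \/ s = - 1 & forall p, L p -> 0 < s * (cu p - cu q)].

Lemma complex_line_level (w1 w2 : R) :
  complex_line [set p : C2 R | cu p = w1 /\ cv p = w2].
Proof.
exists (0, (w1 +i* w2)%C), (1, 0); split.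
  by move/pair_equal_spec => [/eqP]; rewrite oner_eq0.
apply/seteqP; split=> [[z w] /= [<- <-]|p [zeta _ <-]].
  exists z => //; apply/pair_equal_spec; split=> /=.
    by rewrite add0r [_ *: 1]mulr1.
  by rewrite scaler0 addr0 /cu /cv /=; case: (w).
by rewrite /cu /cv /= scaler0 addr0.
Qed.

Lemma wall_exists (a2 b c : R) :
  let phi p := quad a2 b c (cu p) (cv p) in
  ~ complex_line L ->
  (forall p, graph rho p -> 2 * a2 * cv p + c != 0 \/ b - 2 * a2 * cu p != 0) ->
  (forall N, exists k, forall p, L p -> k < `|cu p| -> phi p < N) ->
  (exists m, forall p, L p -> phi p <= m) ->
  exists q s, wall q s /\ forall p, L p -> phi p <= phi q.
Proof.
move=> phi nline nondeg inf bnd.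
have [q [Xq le_q]] := extremal_exists inf bnd.
have Xell := extremal_line rho_smooth fol cleaf nondeg le_q Xq erefl.
(* The point of the line over the z of [p] lies in the closure, hence on the graph; with the same z
   and the same u it has the same v as [p], and [L] would be the line. *)
have nmeet p : L p -> cu p != cu q.
  move=> Lp; apply/eqP => up.
  have vp : cv p = cv q.
    have h1 : cv p = rho (p.1, cu p) by exact: LS Lp.
    have h2 := closure_leaf_graph rho_smooth fol cleaf (Xell (cx p, cy p)).
    have -> : cv q = rho (p.1, cu q) by rewrite [LHS]h2; case: (p) => -[].
    by rewrite h1 up.
  apply: nline.
  rewrite (extremal_leaf rho_smooth fol cleaf nondeg le_q Xq erefl Lp up vp).
  exact: complex_line_level.
have [p0 Lp0] := Lne.
pose s : R := if 0 < cu p0 - cu q then 1 else - 1.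
have s0 : 0 < s * (cu p0 - cu q).
  rewrite /s; have [h|h] := ltrP 0 (cu p0 - cu q); first by rewrite mul1r.
  by rewrite mulN1r oppr_gt0 lt_neqAle h andbT subr_eq0 nmeet.
exists q, s; split=> //; split=> //.
  by rewrite /s; case: ifP; [left|right].
move=> p Lp.
apply: (leaf_ind (P := fun p => 0 < s * (cu p - cu q)) lL _ Lp0 Lp s0).
move=> psi a a' t Apsi La sa.
have [chart _ _] := fol; have [[spsi _ _ _] _] := chart _ Apsi.
have cf : continuous (fun a => s * (cu (psi (a, t)) - cu q)).
  have csl : continuous (fun a => cu (psi (a, t))).
    apply: (continuous_comp2 (f := fun a : R * R => (a, t)) (g := cu \o psi)).
      by apply: continuous_pair => b'; [exact: cvg_id|exact: cvg_cst].
    exact: continuous_comp2 (chart_continuous spsi) continuous_cu.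
  by move=> b'; apply: cvgM; [exact: cvg_cst|apply: cvgB; [exact: csl|exact: cvg_cst]].
have sn0 : s != 0 by rewrite /s; case: ifP => _; rewrite ?oppr_eq0 oner_eq0.
apply: (@clopen_all _ _ [set a | 0 < s * (cu (psi (a, t)) - cu q)]).
- by exists a.
(* The strict condition is closed because [cu - cu q] has no zero on [L]. *)
- have -> : [set a | 0 < s * (cu (psi (a, t)) - cu q)] =
      [set a | 0 <= s * (cu (psi (a, t)) - cu q)].
    apply/seteqP; split=> b' /=; first exact: ltW.
    move=> h; rewrite lt_neqAle h andbT eq_sym mulf_neq0// subr_eq0.
    by apply: nmeet; exact: leaf_plaque lL Apsi La.
  apply: (@closed_comp _ _ (fun a => s * (cu (psi (a, t)) - cu q)) [set t | 0 <= t]);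
    last exact: closed_ge.
  by move=> b' _; exact: cf.
- by move=> b' hb'; exact: (cvgr_gt _ (cf b')).
Qed.

Lemma wall_closure q s p : wall q s -> closure L p -> 0 <= s * (cu p - cu q).
Proof.
move=> [_ _ _ h] Xp.
have cf : continuous (fun p => s * (cu p - cu q)).
  by move=> p'; apply: cvgM; [exact: cvg_cst|apply: cvgB; [exact: continuous_cu|exact: cvg_cst]].
have cl : closed [set p | 0 <= s * (cu p - cu q)].
  apply: (@closed_comp _ _ (fun p => s * (cu p - cu q)) [set t | 0 <= t]);
    last exact: closed_ge.
  by move=> b' _; exact: cf.
by apply: cl => B /Xp[p' [Lp' Bp']]; exists p'; split=> //; exact: ltW (h _ Lp').
Qed.

(** Each [q] is in the closure of [L], hence weakly on the side [s] of the other line, so the values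
    of u agree. Then so do those of v, both given by the graph over z = 0. *)
Lemma wall_unique q q' s : wall q s -> wall q' s -> cu q = cu q' /\ cv q = cv q'.
Proof.
move=> w w'.
have h1 := wall_closure w (let: And4 X _ _ _ := w' in X).
have h2 := wall_closure w' (let: And4 X _ _ _ := w in X).
have uE : cu q = cu q'.
  have [_ _ s1 _] := w; apply/eqP; rewrite eq_le.
  by move: h1 h2; case: s1 => ->; rewrite ?mul1r ?mulN1r ?oppr_ge0 ?subr_ge0 ?subr_le0 => -> ->.
split=> //.
have [_ X _ _] := w; have [_ X' _ _] := w'.
have h : cv q = rho ((0 +i* 0)%C, cu q).
  exact: closure_leaf_graph rho_smooth fol cleaf _ (X (0, 0)).
have h' : cv q' = rho ((0 +i* 0)%C, cu q').
  exact: closure_leaf_graph rho_smooth fol cleaf _ (X' (0, 0)).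
by rewrite h h' uE.
Qed.

(** If the affine function were constant, every point of [L] would be extremal, so u would be
    constant on [L] and, by closure, equal to [cu q]. *)
Lemma wall_not_flat q s (b c m : R) : wall q s -> c != 0 \/ b != 0 ->
  ~ (forall p, L p -> quad 0 b c (cu p) (cv p) = m).
Proof.
move=> w bc const.
have [p0 Lp0] := Lne.
have u0 p : L p -> cu p = cu p0.
  move=> Lp; apply: (leaf_ind (P := fun p => cu p = cu p0) lL _ Lp0 Lp erefl).
  move=> psi a a' t Apsi La <-.
  have nd p' : graph rho p' -> 2 * 0 * cv p' + c != 0 \/ b - 2 * 0 * cu p' != 0.
    by rewrite mulr0 !mul0r add0r subr0.
  have le_m p' : L p' -> quad 0 b c (cu p') (cv p') <= m by move/const ->.
  by have [] := extremal_plaque rho_smooth fol cleaf nd le_m a' Apsi (subset_closure La) (const _ La).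
have [Xq _ _ h] := w.
have cl : closed [set p : C2 R | cu p = cu p0].
  apply: (@closed_comp _ _ cu [set cu p0]); last exact: closed_eq.
  by move=> p _; exact: continuous_cu.
have uq : cu q = cu p0 by apply: cl => B /Xq[p [/u0 pu Bp]]; exists p.
by have := h _ Lp0; rewrite uq subrr mulr0 ltxx.
Qed.

End Walls.

(** * One wall or two walls: conclusion *)

Lemma mulr_le_norm {R : realType} (k v M : R) : `|v| <= M -> k * v <= `|k| * M.
Proof.
move=> vM; apply: le_trans (ler_norm _) _.
by rewrite normrM ler_wpM2l.
Qed.

(** The coefficient [2 * M + 1] makes the derivative [2 * v + 2 * M + 1] in v at least 1 on the
    strip, which ensures the nondegeneracy required by the maximum principle. *)
Lemma quad_strip {R : realType} (M u v : R) : `|v| <= M ->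
  quad 1 0 (2 * M + 1) u v <= M ^+ 2 + (2 * M + 1) * M - u ^+ 2.
Proof.
move=> vM; have M0 : 0 <= M by exact: le_trans vM.
have v2 : v ^+ 2 <= M ^+ 2 by rewrite -(real_normK (num_real v)) ler_pXn2r.
have vM' : (2 * M + 1) * v <= (2 * M + 1) * M.
  by rewrite ler_wpM2l ?addr_ge0 ?mulr_ge0// (le_trans (ler_norm _)).
by rewrite /quad mul1r mul0r addr0 addrAC lerD2r lerD.
Qed.

Lemma side_far {R : realType} (s u a k : R) : s = 1 \/ s = - 1 ->
  0 < s * (u - a) -> `|a| <= k -> k < `|u| -> s * u = `|u|.
Proof.
move=> [] -> h ak ku; have := ler_norm a; have := ler_norm (- a); rewrite normrN.
  by move: ku; case: (ger0P u) => u0; move: h ak u0; clear; move=> *; lra.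
by move: ku; case: (ger0P u) => u0; move: h ak u0; clear; move=> *; lra.
Qed.

Lemma between_bound {R : realType} (s u a b : R) : s = 1 \/ s = - 1 ->
  0 < s * (u - a) -> 0 < - s * (u - b) -> `|u| <= `|a| + `|b|.
Proof.
have := ler_norm a; have := ler_norm (- a); have := ler_norm b; have := ler_norm (- b).
rewrite !normrN ler_norml => h1 h2 h3 h4 [] -> h5 h6; apply/andP.
  by move: h1 h2 h3 h4 h5 h6; clear; split; lra.
by move: h1 h2 h3 h4 h5 h6; clear; split; lra.
Qed.

Lemma all_multiples_le {R : realType} (e d : R) : (forall k, k * e <= d) -> e = 0.
Proof.
move=> h; apply: contrapT => /eqP e0; have := h ((d + 1) / e).
by rewrite divfK// gerDl ler10.
Qed.

Theorem theorem2p2 (R : realType) (rho : C R * R -> R)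
    (A : set (R * R * R -> C2 R)) (L : set (C2 R)) :
  smooth (fun a : R * R * R => rho ((a.1.1 +i* a.1.2)%C, a.2)) ->
  properly_foliated (graph rho) A ->
  [bounded rho q | q in setT] ->
  complex_leaf (graph rho) A L ->
  complex_line L.
Proof.
move=> rs [fol prop] bnd cl; have [lL _] := cl.
have pe := prop _ lL.
have [M rhoM] : exists M : R, forall q, `|rho q| <= M.
  by have [M [_ hM]] := bnd; exists (M + 1) => q; apply: hM => //; rewrite ltrDl.
have cvM p : L p -> `|cv p| <= M.
  by move=> /(leaf_sub fol lL); rewrite /graph /= /cv => ->; exact: rhoM.
have M0 : 0 <= M by apply: le_trans (rhoM (0, 0)).
apply: contrapT => nline.
have ex := wall_exists rs fol cl pe rhoM nline.
(* Nothing bounds u from either side yet, so the first wall comes from the quadratic function. *)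
have [q1 [s [w1 _]]] : exists q s, wall L q s /\
    forall p, L p -> quad 1 0 (2 * M + 1) (cu p) (cv p) <= quad 1 0 (2 * M + 1) (cu q) (cv q).
  apply: ex.
  - move=> p; rewrite /graph/= => vp; left.
    have : `|cv p| <= M by rewrite /cv vp; exact: rhoM.
    rewrite ler_norml => /andP[h _]; rewrite mulr1 gt_eqF//.
    by move: h; clear; lra.
  - move=> N; pose K := M ^+ 2 + (2 * M + 1) * M.
    exists (`|K - N| + 1) => p Lp up.
    apply: le_lt_trans (quad_strip (cu p) (cvM _ Lp)) _.
    have h1 : `|K - N| < cu p ^+ 2.
      have h0 := normr_ge0 (K - N).
      rewrite -(real_normK (num_real (cu p))).
      by move: up h0; move: `|K - N| `|cu p|; clear; move=> *; nra.
    by rewrite ltrBlDr -ltrBlDl; apply: le_lt_trans h1; exact: ler_norm.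
  - exists (M ^+ 2 + (2 * M + 1) * M) => p Lp.
    apply: le_trans (quad_strip (cu p) (cvM _ Lp)) _.
    by rewrite gerBl sqr_ge0.
have [_ _ s1 side] := w1.
have sn0 : s != 0 by case: s1 => ->; rewrite ?oppr_eq0 oner_eq0.
have lin (b c : R) : c != 0 \/ b != 0 -> forall p : C2 R, graph rho p ->
    2 * 0 * cv p + c != 0 \/ b - 2 * 0 * cu p != 0.
  by move=> bc p _; rewrite mulr0 !mul0r add0r subr0.
(* On the side [s] of the first wall, [- s u + k v] is bounded above and tends to minus infinity
   with |u|, whatever the slope [k]. *)
have lines k : exists q s', wall L q s' /\ forall p, L p ->
    quad 0 (- s) k (cu p) (cv p) <= quad 0 (- s) k (cu q) (cv q).
  apply: ex; first by apply: lin; right; rewrite oppr_eq0.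
    move=> N; exists (`|cu q1| + `|k| * M + `|N|) => p Lp up.
    have ha : `|cu q1| <= `|cu q1| + `|k| * M + `|N|.
      by rewrite -addrA lerDl addr_ge0// mulr_ge0.
    have E := side_far s1 (side _ Lp) ha up.
    rewrite /quad mul0r add0r mulNr E.
    have h1 := mulr_le_norm k (cvM _ Lp).
    have h2 := normr_ge0 (cu q1); have := ler_norm (- N); rewrite normrN => h3.
    move: up h1 h2 h3; move: (k * cv p) (`|k| * M) `|cu p| `|cu q1| `|N|.
    by clear; move=> *; lra.
  exists (- (s * cu q1) + `|k| * M) => p Lp.
  rewrite /quad mul0r add0r mulNr lerD//; last exact: mulr_le_norm (cvM _ Lp).
  by have := side _ Lp; rewrite mulrBr subr_gt0 lerN2; exact: ltW.
have [[q2 w2]|none] := pselect (exists q2, wall L q2 (- s)).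
  have [_ _ _ side2] := w2.
  (* Between two walls u is bounded, so every nonconstant affine function peaks on some wall; by
     uniqueness on each side, it is one of these two. *)
  have lines2 b c : c != 0 \/ b != 0 -> forall p, L p ->
      quad 0 b c (cu p) (cv p) <= quad 0 b c (cu q1) (cv q1) \/
      quad 0 b c (cu p) (cv p) <= quad 0 b c (cu q2) (cv q2).
    move=> bc.
    have uB p : L p -> `|cu p| <= `|cu q1| + `|cu q2|.
      by move=> Lp; exact: between_bound s1 (side _ Lp) (side2 _ Lp).
    have [q [s' [w le_q]]] : exists q s', wall L q s' /\ forall p, L p ->
        quad 0 b c (cu p) (cv p) <= quad 0 b c (cu q) (cv q).
      apply: ex; first exact: lin.
        move=> N; exists (`|cu q1| + `|cu q2|) => p Lp.
        by rewrite ltNge uB.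
      exists (`|b| * (`|cu q1| + `|cu q2|) + `|c| * M) => p Lp.
      rewrite /quad mul0r add0r lerD//; first exact: mulr_le_norm (uB _ Lp).
      exact: mulr_le_norm (cvM _ Lp).
    have [s's|s's] : s' = s \/ s' = - s.
      have [_ _ s'1 _] := w.
      by case: s1 => ->; case: s'1 => ->; rewrite ?opprK; [left|right|right|left].
      rewrite s's in w; have [uE vE] := wall_unique rs fol cl w w1.
      by move=> p Lp; left; rewrite -uE -vE; exact: le_q.
    rewrite s's in w; have [uE vE] := wall_unique rs fol cl w w2.
    by move=> p Lp; right; rewrite -uE -vE; exact: le_q.
  (* the affine function taking the same value on both walls *)
  pose b := - (cv q2 - cv q1); pose c := cu q2 - cu q1.
  have cn0 : c != 0.
    have [p0 _ LE] := lL.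
    have Lp0 : L p0 by rewrite LE; exact: Relation_Operators.rt_refl.
    apply/eqP => c0; have h1 := side _ Lp0; have h2 := side2 _ Lp0.
    have uE : cu q2 = cu q1 by apply/eqP; rewrite -subr_eq0; apply/eqP.
    by move: h2; rewrite uE mulNr oppr_gt0 ltNge (ltW h1).
  have E : quad 0 b c (cu q2) (cv q2) = quad 0 b c (cu q1) (cv q1).
    by rewrite /quad /b /c; ring.
  apply: (wall_not_flat rs fol cl w1 (or_introl cn0) (b := b)
    (m := quad 0 b c (cu q1) (cv q1))) => p Lp.
  have qN (u v : R) : quad 0 (- b) (- c) u v = - quad 0 b c u v.
    by rewrite /quad; ring.
  apply/eqP; rewrite eq_le; apply/andP; split.
    by have [] := lines2 b c (or_introl cn0) p Lp; rewrite ?E.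
  have cNn0 : - c != 0 by rewrite oppr_eq0.
  have := lines2 (- b) (- c) (or_introl cNn0) p Lp.
  by rewrite !qN E !lerN2 => -[].
(* Without a wall on the other side, every [- s u + k v] peaks at [q1]: hence [k * (cv p - cv q1)]
   is at most [s * (cu p - cu q1)] for all [k] of either sign, and v is constant. *)
apply: (wall_not_flat rs fol cl w1 (or_introl (oner_neq0 R)) (b := 0) (m := cv q1)) => p Lp.
rewrite /quad !mul0r !add0r mul1r; apply/subr0_eq.
apply: (@all_multiples_le _ _ (s * (cu p - cu q1))) => k.
have [q [s' [w le_q]]] := lines k.
have s's : s' = s.
  have [_ _ s'1 _] := w; apply: contrapT => ns.
  apply: none; exists q; suff <- : s' = - s by [].
  by case: s1 ns => ->; case: s'1 => ->; rewrite ?opprK.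
rewrite s's in w; have [uE vE] := wall_unique rs fol cl w w1.
have := le_q _ Lp; rewrite /quad !mul0r !add0r uE vE.
by rewrite !mulNr !mulrBr -subr_ge0 => h; rewrite -subr_ge0; apply: le_trans h _; rewrite le_eqVlt; apply/orP; left; apply/eqP; ring.
Qed.
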